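(* Let $F$ be a real odd entire function, and let $x_j=\dfrac{(-1)^j}{\ln(j+2)}$ for $j\geq 0$. For each sequence of real numbers $\{\mu_m\}_{m=0}^\infty$ and for each $c\in\mathbb{R}$ there exists a rearrangement $\{u_j\}_{j=0}^\infty$ of the sequence $\{x_j\}_{j=0}^\infty$ such that $$\sum_{j=0}^\infty u_j^{2m+1}=\mu_m\quad\text{for all } m\geq 0,$$ and such that $\sum_{j=0}^\infty F(u_j)=c$.
   Context: A real odd entire function is an entire function $F$ with $F(\mathbb{R})\subset\mathbb{R}$ and $F(-z)=-F(z)$. A rearrangement of $\{x_j\}_{j=0}^\infty$ is a sequence $\{x_{\sigma(j)}\}_{j=0}^\infty$ with $\sigma$ a bijection of $\{0,1,2,\ldots\}$. Series are sums in the ordinary sense (limits of partial sums in the given order), possibly only conditionally convergent.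
   Formalization: F is additionally assumed not to be a polynomial; for an odd polynomial F(z) = Σ a_k z^{2k+1} the sum Σ F(u_j) is forced to equal Σ a_k μ_k, so the claim fails for every other c (e.g. F = 0, c = 1). *)

(* Defs.v *)
From Stdlib Require Export Reals FinFun.
From Coquelicot Require Export Coquelicot.
Open Scope R_scope.

Definition entire (F : C -> C) : Prop :=
  forall z : C, @ex_derive C_AbsRing C_NormedModule F z.

(* Polynomials have to be excluded when the power sums mu_m and the value c are
   prescribed independently: for F(z) = a_0 z + ... + a_n z^(2n+1) the sum of
   the F(u_j) is forced to be a_0 mu_0 + ... + a_n mu_n. *)
Definition polynomial_function (F : C -> C) : Prop :=
  exists (n : nat) (a : nat -> C),
    forall z : C, F z = sum_n (fun k => Cmult (a k) (Cpow z k)) n.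

Record real_odd_entire (F : C -> C) : Prop := {
  roe_entire : entire F;
  roe_real : forall x : R, exists y : R, F (RtoC x) = RtoC y;
  roe_odd : forall z : C, F (Copp z) = Copp (F z)
}.

Definition rearrangement (u x : nat -> R) : Prop :=
  exists sigma : nat -> nat, Bijective sigma /\ forall j : nat, u j = x (sigma j).

Definition xseq (j : nat) : R := (-1) ^ j / ln (INR j + 2).

(* Main.v *)
Require Import Defs.
From Stdlib Require Import Lra Lia Classical ClassicalEpsilon List Compare_dec.
From Stdlib Require Import ssreflect.
Import ListNotations.
Local Open Scope general_if_scope.

(** Why the theorem holds.  Write g_0 = F and g_(m+1)(x) = x^(2m+1), as functions on
the real line.  All of them are odd, with asymptotic expansions in odd powers at
0.  A finite nontrivial linear combination of them is equivalent at 0 to some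
C x^(2k+1) with C <> 0, because F is not a polynomial, and 1 / ln(j+2) decays so
slowly that each sum of |x_j|^(2k+1) diverges.  This is a Levy-Steinitz
situation in which every value of all the sums is attainable.  Instead of a
general Levy-Steinitz theorem the proof uses explicit finite blocks of terms.

Analytic part.  Complex differentiability of F everywhere (with no continuity
assumed on the derivative) has to give the expansions F(z) = sum_(k<n) A_k z^k +
O(z^n), as well as the fact that F is a polynomial when almost all A_k vanish.
In logarithmic polar coordinates w = exp(s + i t) the Goursat theorem on
rectangles says that the circle integral of a function over |w| = r does not
depend on r ([circle_int_annulus]).  One exceptional point is crossed by
continuity in r ([circle_int_one_exception]), which gives the Cauchy formula
([cauchy_formula]) and then the Taylor estimate ([taylor]).  For a real odd F
the outcome is [real_odd_expansion].

Blocks.  The point set [gadget] k y, with multiplicities, consists of points of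
size about y at which the odd power sums of order less than k cancel exactly
while the one of order k is a nonzero multiple of y^(2k+1).  Repeating it about
r / y^(2k+1) times moves the k-th odd power sum by r, at a cost O(y) in all
higher ones.  Near a point p there are exponentially many (in 1/|p|) terms x_j
exponentially close to p ([xseq_near]), whereas only polynomially many are
needed; so the points can be replaced by distinct unused terms
([move_power_sum]).

Steering.  A vector t is reachable ([reach]) if blocks of fresh terms can move
the first d sums by any multiple of t under a linear control of the partial
sums.  Reachable vectors form a linear space.  It contains the vector of k-th
expansion coefficients for each k ([reach_order]), hence it is everything
([reach_all]): for k >= d only F contributes, and k can be chosen with a
nonzero coefficient.  Dividing a displacement into many small ones makes the
partial sums follow the segment from 0 to t closely ([reach_segment]).

Rearrangement.  Stage n corrects the first n + 1 sums up to a small error by a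
fresh block and then spends the index n.  A sum that has been corrected before
hardly moves during later stages, hence all sums converge to their targets
([order_cv]). *)

(** * Complex continuity and differentiability at a point *)

Definition ccont (f : C -> C) (w : C) : Prop :=
  forall eps, 0 < eps -> exists d, 0 < d /\
    forall w', Cmod (w' - w) < d -> Cmod (f w' - f w) < eps.

(** The form of differentiability due to Caratheodory: the difference quotient
    extends continuously to w.  Sums, products and compositions then
    differentiate by algebra alone. *)
Definition cdiff (f : C -> C) (w : C) : Prop :=
  exists g, ccont g w /\ forall w', (f w' - f w = g w' * (w' - w))%C.

Lemma ccont_const c w : ccont (fun _ => c) w.
Proof.
  move=> e he; exists 1; split; first lra.
  move=> w' _; replace (c - c)%C with (RtoC 0) by ring.
  by rewrite Cmod_0.
Qed.

Lemma ccont_id w : ccont (fun z => z) w.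
Proof. move=> e he; exists e; split => //. Qed.

Lemma ccont_plus f g w : ccont f w -> ccont g w -> ccont (fun z => f z + g z)%C w.
Proof.
  move=> hf hg e he.
  case: (hf (e/2)) => [|d1 [hd1 h1]]; first lra.
  case: (hg (e/2)) => [|d2 [hd2 h2]]; first lra.
  exists (Rmin d1 d2); split; first by apply: Rmin_pos.
  move=> w' hw.
  have := h1 w' (Rlt_le_trans _ _ _ hw (Rmin_l _ _)).
  have := h2 w' (Rlt_le_trans _ _ _ hw (Rmin_r _ _)).
  have := Cmod_triangle (f w' - f w) (g w' - g w).
  replace (f w' + g w' - (f w + g w))%C with (f w' - f w + (g w' - g w))%C by ring.
  lra.
Qed.

Lemma ccont_mult f g w : ccont f w -> ccont g w -> ccont (fun z => f z * g z)%C w.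
Proof.
  move=> hf hg e he.
  set A := 1 + Cmod (f w) + Cmod (g w).
  have hA : 1 <= A by rewrite /A; have := Cmod_ge_0 (f w); have := Cmod_ge_0 (g w); lra.
  have hea : 0 < e / (3 * A) by apply: Rdiv_lt_0_compat; lra.
  case: (hf (Rmin 1 (e / (3*A)))) => [|d1 [hd1 h1]]; first by apply: Rmin_pos; lra.
  case: (hg (Rmin 1 (e / (3*A)))) => [|d2 [hd2 h2]]; first by apply: Rmin_pos; lra.
  exists (Rmin d1 d2); split; first by apply: Rmin_pos.
  move=> w' hw.
  have H1 := h1 w' (Rlt_le_trans _ _ _ hw (Rmin_l _ _)).
  have H2 := h2 w' (Rlt_le_trans _ _ _ hw (Rmin_r _ _)).
  have := Rmin_l 1 (e / (3*A)); have := Rmin_r 1 (e / (3*A)) => m1 m2.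
  replace (f w' * g w' - f w * g w)%C with
    ((f w' - f w) * (g w' - g w) + (f w * (g w' - g w) + g w * (f w' - f w)))%C by ring.
  apply: Rle_lt_trans (Cmod_triangle _ _) _.
  apply: Rle_lt_trans (Rplus_le_compat_l _ _ _ (Cmod_triangle _ _)) _.
  rewrite !Cmod_mult.
  set a := Cmod (f w' - f w) in H1 *; set b := Cmod (g w' - g w) in H2 *.
  have a0 : 0 <= a by apply: Cmod_ge_0.
  have b0 : 0 <= b by apply: Cmod_ge_0.
  have f0 := Cmod_ge_0 (f w); have g0 := Cmod_ge_0 (g w).
  have e3 : A * (e / (3 * A)) = e / 3 by field; lra.
  have : A * a <= A * (e / (3*A)) by apply: Rmult_le_compat_l; lra.
  have : A * b <= A * (e / (3*A)) by apply: Rmult_le_compat_l; lra.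
  rewrite e3 /A => i1 i2.
  nra.
Qed.

Lemma Cmod_sub_sym a b : Cmod (a - b) = Cmod (b - a).
Proof. by rewrite -Cmod_opp; congr Cmod; ring. Qed.

Lemma Cmod_rev a b : Cmod a - Cmod (b - a) <= Cmod b.
Proof.
  have := Cmod_triangle b (a - b).
  replace (b + (a - b))%C with a by ring. rewrite (Cmod_sub_sym a b); lra.
Qed.

Lemma ccont_inv f w : ccont f w -> f w <> 0 -> ccont (fun z => / f z)%C w.
Proof.
  move=> hf h0 e he.
  have hm : 0 < Cmod (f w) by apply/Cmod_gt_0.
  set m := Cmod (f w) in hm *.
  case: (hf (Rmin (m/2) (e * m^2 / 2))) => [|d [hd h]].
  { apply: Rmin_pos; first lra. apply: Rdiv_lt_0_compat; last lra.
    apply: Rmult_lt_0_compat => //. nra. }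
  exists d; split => // w' hw.
  have H := h w' hw.
  have m1 := Rmin_l (m/2) (e * m^2 / 2); have m2 := Rmin_r (m/2) (e * m^2 / 2).
  have h2 : m / 2 < Cmod (f w') by have := Cmod_rev (f w) (f w'); rewrite -/m; lra.
  have h3 : f w' <> 0 by move=> h3; rewrite h3 Cmod_0 in h2; lra.
  replace (/ f w' - / f w)%C with (- (f w' - f w) / (f w' * f w))%C by (field; split => //).
  rewrite Cmod_div; last by apply: Cmult_neq_0.
  rewrite Cmod_opp Cmod_mult -/m.
  apply (Rmult_lt_reg_r (Cmod (f w') * m)); first nra.
  unfold Rdiv. rewrite Rmult_assoc Rinv_l; last nra.
  have : m * m / 2 <= Cmod (f w') * m by nra.
  move=> k. have : e * (m * m / 2) <= e * (Cmod (f w') * m) by apply: Rmult_le_compat_l; lra.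
  lra.
Qed.

Lemma ccont_comp f g w : ccont g w -> ccont f (g w) -> ccont (fun z => f (g z)) w.
Proof.
  move=> hg hf e he. case: (hf e he) => d [hd h]. case: (hg d hd) => d' [hd' h'].
  exists d'; split => // w' hw. apply: h. by apply: h'.
Qed.

Lemma ccont_loc f g w d : 0 < d -> (forall w', Cmod (w' - w) < d -> f w' = g w') ->
  ccont f w -> ccont g w.
Proof.
  move=> hd h hf e he. case: (hf e he) => d' [hd' h'].
  exists (Rmin d d'); split; first by apply: Rmin_pos.
  move=> w' hw. rewrite -h; last by apply: Rlt_le_trans hw (Rmin_l _ _).
  rewrite -h. 2:{ replace (w - w)%C with (RtoC 0) by ring. by rewrite Cmod_0. }
  apply: h'; by apply: Rlt_le_trans hw (Rmin_r _ _).
Qed.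

Lemma ccont_minus f g w : ccont f w -> ccont g w -> ccont (fun z => f z - g z)%C w.
Proof.
  move=> hf hg. apply: (ccont_loc (fun z => f z + (RtoC (-1)) * g z)%C _ _ 1); first lra.
  { move=> w' _. apply: injective_projections => /=; ring. }
  apply: ccont_plus => //. apply: ccont_mult => //. exact: ccont_const.
Qed.

(** Only the values of f near w matter: away from w the difference quotient
    itself serves as slope function. *)
Lemma cdiff_intro f g w d : 0 < d -> ccont g w ->
  (forall w', Cmod (w' - w) < d -> f w' - f w = g w' * (w' - w))%C -> cdiff f w.
Proof.
  move=> hd hg h.
  exists (fun w' => if Rlt_dec (Cmod (w' - w)) d then g w' else ((f w' - f w) / (w' - w))%C).
  split.
  - apply: (ccont_loc g _ _ d) => // w' hw. by case: Rlt_dec.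
  - move=> w'. case: Rlt_dec => hw; first by apply: h.
    field => h0. apply: hw. by rewrite h0 Cmod_0.
Qed.

Lemma cdiff_cont f w : cdiff f w -> ccont f w.
Proof.
  move=> [g [hg h]].
  apply: (ccont_loc (fun z => f w + g z * (z + - w))%C _ _ 1); first lra.
  { move=> w' _. have := h w' => /= e. change (w' + - w)%C with (w' - w)%C. rewrite -e. ring. }
  apply: ccont_plus; first by apply: ccont_const.
  apply: ccont_mult => //. apply: ccont_plus; [by apply: ccont_id | by apply: ccont_const].
Qed.

Lemma cdiff_const c w : cdiff (fun _ => c) w.
Proof. exists (fun _ => RtoC 0); split; first by apply: ccont_const. move=> w'; ring. Qed.

Lemma cdiff_id w : cdiff (fun z => z) w.
Proof. exists (fun _ => RtoC 1); split; first by apply: ccont_const. move=> w'; ring. Qed.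

Lemma cdiff_plus f g w : cdiff f w -> cdiff g w -> cdiff (fun z => f z + g z)%C w.
Proof.
  move=> [f' [hf ef]] [g' [hg eg]]. exists (fun z => f' z + g' z)%C; split; first by apply: ccont_plus.
  move=> w'. rewrite Cmult_plus_distr_r -ef -eg. ring.
Qed.

Lemma cdiff_mult f g w : cdiff f w -> cdiff g w -> cdiff (fun z => f z * g z)%C w.
Proof.
  move=> cf cg. have gc := cdiff_cont _ _ cg. move: cf cg.
  move=> [f' [hf ef]] [g' [hg eg]]. exists (fun z => f' z * g z + f w * g' z)%C; split.
  - apply: ccont_plus; apply: ccont_mult => //. by apply: ccont_const.
  - move=> w'.
    replace (f w' * g w' - f w * g w)%C with ((f w' - f w) * g w' + f w * (g w' - g w))%C by ring.
    rewrite ef eg. ring.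
Qed.

Lemma ccont_nz f w : ccont f w -> f w <> 0 ->
  exists d, 0 < d /\ forall w', Cmod (w' - w) < d -> f w' <> 0.
Proof.
  move=> hf h0. have hm : 0 < Cmod (f w) by apply/Cmod_gt_0.
  case: (hf _ hm) => d [hd h]. exists d; split => // w' hw e.
  have := h w' hw. rewrite e. replace (0 - f w)%C with (- f w)%C by ring. rewrite Cmod_opp. lra.
Qed.

Lemma cdiff_inv f w : cdiff f w -> f w <> 0 -> cdiff (fun z => / f z)%C w.
Proof.
  move=> cf h0. have fc := cdiff_cont _ _ cf.
  case: (ccont_nz _ _ fc h0) => d [hd hnz]. move: cf => [f' [hf ef]].
  apply: (cdiff_intro _ (fun z => - f' z * / (f z * f w))%C w d) => //.
  - apply: ccont_mult.
    + apply: (ccont_loc (fun z => (RtoC (-1)) * f' z)%C _ _ 1); first lra.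
      { move=> w' _. apply: injective_projections => /=; ring. }
      apply: ccont_mult => //. by apply: ccont_const.
    + apply: ccont_inv; last by apply: Cmult_neq_0.
      apply: ccont_mult => //. by apply: ccont_const.
  - move=> w' hw. have := hnz w' hw => hn.
    replace (/ f w' - / f w)%C with (- (f w' - f w) * / (f w' * f w))%C by (field; split => //).
    rewrite ef. ring.
Qed.

Lemma cdiff_comp f g w : cdiff g w -> cdiff f (g w) -> cdiff (fun z => f (g z)) w.
Proof.
  move=> cg. have gc := cdiff_cont _ _ cg. move: cg => [g' [hg eg]] [f' [hf ef]].
  exists (fun z => f' (g z) * g' z)%C; split.
  - apply: ccont_mult => //. by apply: (ccont_comp f' g).
  - move=> w'. rewrite ef eg. ring.
Qed.

Lemma cdiff_pow f n w : cdiff f w -> cdiff (fun z => f z ^ n)%C w.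
Proof.
  move=> h; elim: n => [|n IH] /=; first by apply: cdiff_const. by apply: cdiff_mult.
Qed.

Lemma cdiff_minus f g w : cdiff f w -> cdiff g w -> cdiff (fun z => f z - g z)%C w.
Proof.
  move=> hf hg.
  have h : cdiff (fun z => f z + (RtoC (-1)) * g z)%C w.
  { apply: cdiff_plus => //. apply: cdiff_mult => //. by apply: cdiff_const. }
  move: h => [k [hk ek]]. exists k; split => // w'. rewrite -ek.
  apply: injective_projections => /=; ring.
Qed.

Lemma cdiff_of_limit f z l :
  (forall e, 0 < e -> exists d, 0 < d /\ forall w, Cmod (w - z) < d ->
     Cmod (f w - f z - l * (w - z)) <= e * Cmod (w - z)) -> cdiff f z.
Proof.
  move=> hl.
  exists (fun w => if Ceq_dec w z then l else ((f w - f z) / (w - z))%C); split; last first.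
  { move=> w'. case: Ceq_dec => [->|hn]; first ring. field. move=> e; apply: hn.
    replace w' with (w' - z + z)%C by ring. rewrite e; ring. }
  move=> e he.
  case: (hl (e / 2)) => [|d [hd h]]; first lra.
  exists d; split => // w' hw. case: Ceq_dec => [e1|hn].
  { case: Ceq_dec => // _. replace (l - l)%C with (RtoC 0) by ring. by rewrite Cmod_0. }
  case: Ceq_dec => // _.
  have hh := h w' hw.
  have hnz : (w' - z)%C <> 0.
  { move=> e0; apply: hn. replace w' with (w' - z + z)%C by ring. rewrite e0; ring. }
  replace ((f w' - f z) / (w' - z) - l)%C with ((f w' - f z - l * (w' - z)) / (w' - z))%C by (field; auto).
  rewrite Cmod_div //.
  have hp : 0 < Cmod (w' - z) by apply/Cmod_gt_0.
  apply: Rle_lt_trans (_ : e / 2 < e); last lra.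
  apply (Rmult_le_reg_r (Cmod (w' - z))) => //.
  unfold Rdiv at 1. rewrite Rmult_assoc Rinv_l; lra.
Qed.

Lemma cdiff_of_ex_derive F z : @ex_derive C_AbsRing C_NormedModule F z -> cdiff F z.
Proof.
  move=> [l [_ hl]]. have {}hl := hl z (fun P H => H).
  apply: (cdiff_of_limit _ _ l) => e he. case: (hl (mkposreal _ he)) => d hd.
  exists d; split; first by apply: cond_pos.
  move=> w hw. rewrite (Cmult_comm l). exact: hd w hw.
Qed.

Lemma cdiff_ext f g w : (forall z, f z = g z) -> cdiff f w -> cdiff g w.
Proof. move=> h [k [hk e]]. exists k; split => // w'. by rewrite -!h. Qed.

Lemma cdiff_loc f g w d : 0 < d -> (forall z, Cmod (z - w) < d -> f z = g z) -> cdiff f w -> cdiff g w.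
Proof.
  move=> hd h [k [hk e]]. apply: (cdiff_intro _ k _ d) => // w' hw. rewrite -!h //.
  replace (w - w)%C with (RtoC 0) by ring. by rewrite Cmod_0.
Qed.

(** * The Goursat theorem on rectangles *)

(** Counterclockwise line integral of P dx - Q dy along the boundary of the
    rectangle [a, b] x [c, d]; for P = Re G and Q = Im G it is the real part of the
    contour integral of G. *)
Definition boundary_int (P Q : R -> R -> R) (a b c d : R) : R :=
  (RInt (fun x => P x c) a b - RInt (fun x => P x d) a b)
  - (RInt (fun y => Q b y) c d - RInt (fun y => Q a y) c d).

Definition closed_at (P Q : R -> R -> R) (x y : R) : Prop :=
  exists px py qx qy, differentiable_pt_lim P x y px py /\
    differentiable_pt_lim Q x y qx qy /\ py + qx = 0.

Lemma differentiable_slice1 f x y lx ly :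
  differentiable_pt_lim f x y lx ly -> continuous (fun t => f t y) x.
Proof.
  move=> h. have hh : continuity_2d_pt f x y by apply: differentiable_continuity_pt; exists lx, ly.
  apply/filterlim_locally => eps. case: (hh eps) => d hd. exists d => t ht.
  apply: hd => //. rewrite Rminus_diag Rabs_R0; exact: cond_pos.
Qed.

Lemma differentiable_slice2 f x y lx ly :
  differentiable_pt_lim f x y lx ly -> continuous (fun t => f x t) y.
Proof.
  move=> h. have hh : continuity_2d_pt f x y by apply: differentiable_continuity_pt; exists lx, ly.
  apply/filterlim_locally => eps. case: (hh eps) => d hd. exists d => t ht.
  apply: hd => //. rewrite Rminus_diag Rabs_R0; exact: cond_pos.
Qed.

(** The affine part of the field contributes
    - (py + qx) (b - a) (d - c) = 0, so only the error of the linear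
    approximation is left, which is small compared with the size of the
    rectangle, and it is integrated over a length of that size. *)
Lemma boundary_int_local P Q x0 y0 e : closed_at P Q x0 y0 -> 0 < e ->
  exists del, 0 < del /\ forall a b c d,
    a <= x0 <= b -> c <= y0 <= d -> b - a < del -> d - c < del ->
    (forall y, c <= y <= d -> ex_RInt (fun x => P x y) a b) ->
    (forall x, a <= x <= b -> ex_RInt (fun y => Q x y) c d) ->
    Rabs (boundary_int P Q a b c d) <= e * ((b - a) + (d - c)) ^ 2.
Proof.
  move=> [px [py [qx [qy [hP [hQ hpq]]]]]] he.
  have he2 : 0 < e / 2 by lra.
  case: (hP (mkposreal _ he2)) => d1 h1. case: (hQ (mkposreal _ he2)) => d2 h2.
  exists (Rmin d1 d2); split; first by apply: Rmin_pos; apply: cond_pos.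
  move=> a b c d hx hy hba hdc iP iQ.
  have m1 := Rmin_l d1 d2. have m2 := Rmin_r d1 d2.
  set D := (b - a) + (d - c).
  have hD : 0 <= D by rewrite /D; lra.
  have eP : forall x y, a <= x <= b -> c <= y <= d ->
     Rabs (P x y - P x0 y0 - (px * (x - x0) + py * (y - y0))) <= e / 2 * D.
  { move=> x y ax cy. apply: Rle_trans (h1 x y _ _) _.
    - apply: Rle_lt_trans (_ : _ <= b - a) _; last lra. apply: Rabs_le; lra.
    - apply: Rle_lt_trans (_ : _ <= d - c) _; last lra. apply: Rabs_le; lra.
    - apply: Rmult_le_compat_l; first by simpl; lra.
      apply: Rmax_lub; apply: Rabs_le; rewrite /D; lra. }
  have eQ : forall x y, a <= x <= b -> c <= y <= d ->
     Rabs (Q x y - Q x0 y0 - (qx * (x - x0) + qy * (y - y0))) <= e / 2 * D.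
  { move=> x y ax cy. apply: Rle_trans (h2 x y _ _) _.
    - apply: Rle_lt_trans (_ : _ <= b - a) _; last lra. apply: Rabs_le; lra.
    - apply: Rle_lt_trans (_ : _ <= d - c) _; last lra. apply: Rabs_le; lra.
    - apply: Rmult_le_compat_l; first by simpl; lra.
      apply: Rmax_lub; apply: Rabs_le; rewrite /D; lra. }
  have iPc := iP c ltac:(lra). have iPd := iP d ltac:(lra).
  have iQa := iQ a ltac:(lra). have iQb := iQ b ltac:(lra).
  have IP : is_RInt (fun x => P x c - P x d + py * (d - c)) a b
     (RInt (fun x => P x c) a b - RInt (fun x => P x d) a b + (b - a) * (py * (d - c))).
  { apply: (@is_RInt_plus R_NormedModule); last by apply: is_RInt_const.
    apply: (@is_RInt_minus R_NormedModule); by apply: RInt_correct. }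
  have IQ : is_RInt (fun y => Q b y - Q a y - qx * (b - a)) c d
     (RInt (fun y => Q b y) c d - RInt (fun y => Q a y) c d - (d - c) * (qx * (b - a))).
  { apply: (@is_RInt_minus R_NormedModule); last by apply: is_RInt_const.
    apply: (@is_RInt_minus R_NormedModule); by apply: RInt_correct. }
  have BP : Rabs (RInt (fun x => P x c) a b - RInt (fun x => P x d) a b + (b - a) * (py * (d - c)))
      <= (b - a) * (e * D).
  { rewrite -(is_RInt_unique _ _ _ _ IP). apply: abs_RInt_le_const; [lra | by eexists; exact: IP |].
    move=> t ht. have := Rabs_le_between _ _ => rb.
    have k1 := eP t c ht ltac:(lra). have k2 := eP t d ht ltac:(lra).
    apply Rabs_le_between in k1. apply Rabs_le_between in k2. apply: Rabs_le. nra. }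
  have BQ : Rabs (RInt (fun y => Q b y) c d - RInt (fun y => Q a y) c d - (d - c) * (qx * (b - a)))
      <= (d - c) * (e * D).
  { rewrite -(is_RInt_unique _ _ _ _ IQ). apply: abs_RInt_le_const; [lra | by eexists; exact: IQ |].
    move=> t ht. have := Rabs_le_between _ _ => rb.
    have k1 := eQ a t ltac:(lra) ht. have k2 := eQ b t ltac:(lra) ht.
    apply Rabs_le_between in k1. apply Rabs_le_between in k2. apply: Rabs_le. nra. }
  rewrite /boundary_int. 
  apply Rabs_le_between in BP. apply Rabs_le_between in BQ.
  have -> : e * D ^ 2 = (b - a) * (e * D) + (d - c) * (e * D) by rewrite /D; ring.
  have z : (b - a) * (py * (d - c)) + (d - c) * (qx * (b - a)) = 0.
  { replace (_ + _) with ((b-a)*(d-c)*(py + qx)) by ring. rewrite hpq; ring. }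
  apply: Rabs_le. lra.
Qed.

Lemma pow2_unbounded x : exists n, x < 2 ^ n.
Proof.
  case: (Pow_x_infinity 2 _ (x + 1)) => [|N h]; first by rewrite Rabs_pos_eq; lra.
  exists N. have := h N (le_n _). rewrite Rabs_pos_eq; last by apply: pow_le; lra. lra.
Qed.

Lemma nested_point (u : nat -> R) (A : R) : 0 <= A ->
  (forall n, u n <= u (S n) /\ u (S n) + A / 2 ^ (S n) <= u n + A / 2 ^ n) ->
  exists x, forall n, u n <= x <= u n + A / 2 ^ n.
Proof.
  move=> hA h.
  have pos : forall n, 0 <= A / 2 ^ n.
  { move=> n. apply: Rdiv_le_0_compat => //. apply: pow_lt; lra. }
  have mono : forall n k, u n <= u (n + k)%nat.
  { move=> n; elim=> [|k IH]; first by rewrite Nat.add_0_r; lra.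
    rewrite Nat.add_succ_r. have := proj1 (h (n + k)%nat); lra. }
  have dec : forall n k, u (n + k)%nat + A / 2 ^ (n + k) <= u n + A / 2 ^ n.
  { move=> n; elim=> [|k IH]; first by rewrite Nat.add_0_r; lra.
    rewrite Nat.add_succ_r. have := proj2 (h (n + k)%nat); lra. }
  have cross : forall n m, u n <= u m + A / 2 ^ m.
  { move=> n m. have := mono n m. have := dec m n. have := pos (m + n)%nat.
    rewrite (Nat.add_comm m n). lra. }
  case: (completeness (fun r => exists n, r = u n)) => [||x [ub lub]].
  - exists (u 0%nat + A / 2 ^ 0) => r [n ->]. exact: cross.
  - by exists (u 0%nat), 0%nat.
  - exists x => n; split; first by apply: ub; exists n.
    apply: lub => r [m ->]. exact: cross.
Qed.

Section Goursat.
Variables (P Q : R -> R -> R) (a b c d : R).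
Hypothesis hab : a < b.
Hypothesis hcd : c < d.
Hypothesis hcl : forall x y, a <= x <= b -> c <= y <= d -> closed_at P Q x y.

Lemma ex_RInt_horizontal x1 x2 y : a <= x1 -> x1 <= x2 -> x2 <= b -> c <= y <= d -> ex_RInt (fun x => P x y) x1 x2.
Proof.
  move=> h1 h2 h3 hy. apply: ex_RInt_continuous => z. rewrite Rmin_left // Rmax_right // => hz.
  case: (hcl z y ltac:(lra) hy) => px [py [qx [qy [hP _]]]]. exact: differentiable_slice1 hP.
Qed.

Lemma ex_RInt_vertical y1 y2 x : c <= y1 -> y1 <= y2 -> y2 <= d -> a <= x <= b -> ex_RInt (fun y => Q x y) y1 y2.
Proof.
  move=> h1 h2 h3 hx. apply: ex_RInt_continuous => z. rewrite Rmin_left // Rmax_right // => hz.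
  case: (hcl x z hx ltac:(lra)) => px [py [qx [qy [_ [hQ _]]]]]. exact: differentiable_slice2 hQ.
Qed.

Lemma boundary_int_split x1 x2 x3 y1 y2 y3 :
  a <= x1 -> x1 <= x2 -> x2 <= x3 -> x3 <= b -> c <= y1 -> y1 <= y2 -> y2 <= y3 -> y3 <= d ->
  boundary_int P Q x1 x3 y1 y3 = boundary_int P Q x1 x2 y1 y2 + boundary_int P Q x2 x3 y1 y2
   + boundary_int P Q x1 x2 y2 y3 + boundary_int P Q x2 x3 y2 y3.
Proof.
  move=> *. rewrite /boundary_int.
  have CP : forall y, c <= y <= d -> RInt (fun x => P x y) x1 x3 =
      RInt (fun x => P x y) x1 x2 + RInt (fun x => P x y) x2 x3.
  { move=> y hy. symmetry. apply: (RInt_Chasles (V:=R_CompleteNormedModule)); apply: ex_RInt_horizontal; lra. }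
  have CQ : forall x, a <= x <= b -> RInt (fun y => Q x y) y1 y3 =
      RInt (fun y => Q x y) y1 y2 + RInt (fun y => Q x y) y2 y3.
  { move=> x hx. symmetry. apply: (RInt_Chasles (V:=R_CompleteNormedModule)); apply: ex_RInt_vertical; lra. }
  rewrite (CP y1) ?(CP y3) ?(CQ x1) ?(CQ x3); lra.
Qed.

Let A := b - a.
Let B := d - c.
Let K n (p : R * R) := boundary_int P Q (fst p) (fst p + A / 2 ^ n) (snd p) (snd p + B / 2 ^ n).

Variable e : R.
Hypothesis he : 0 < e.

Let bad n p := e / 4 ^ n < Rabs (K n p).

(** The quarter of a rectangle of level n on which the boundary integral is
    still too large; it exists as soon as that is so on the whole rectangle,
    by additivity. *)
Definition quarter n (p : R * R) : R * R :=
  let s := A / 2 ^ (S n) in let t := B / 2 ^ (S n) in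
  if Rlt_dec (e / 4 ^ (S n)) (Rabs (K (S n) p)) then p else
  if Rlt_dec (e / 4 ^ (S n)) (Rabs (K (S n) (fst p + s, snd p))) then (fst p + s, snd p) else
  if Rlt_dec (e / 4 ^ (S n)) (Rabs (K (S n) (fst p, snd p + t))) then (fst p, snd p + t) else
  (fst p + s, snd p + t).

Fixpoint corner n : R * R :=
  match n with O => (a, c) | S k => quarter k (corner k) end.

Lemma div_pow2_half X n : X / 2 ^ n = X / 2 ^ (S n) + X / 2 ^ (S n).
Proof. simpl; field. apply: pow_nonzero; lra. Qed.

Lemma div_pow2_pos X n : 0 < X -> 0 < X / 2 ^ n.
Proof. move=> h. apply: Rdiv_lt_0_compat => //. apply: pow_lt; lra. Qed.

Lemma quarter_bad n p : a <= fst p -> fst p + A / 2 ^ n <= b -> c <= snd p -> snd p + B / 2 ^ n <= d ->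
  bad n p -> bad (S n) (quarter n p).
Proof.
  move=> h1 h2 h3 h4 hb. rewrite /bad /quarter.
  case: Rlt_dec => // k1. case: Rlt_dec => // k2. case: Rlt_dec => // k3.
  apply: Rnot_le_lt => k4. apply Rnot_lt_le in k1, k2, k3.
  move: hb; rewrite /bad {1}/K. have sA := div_pow2_half A n. have sB := div_pow2_half B n.
  have pA : 0 < A / 2 ^ S n by apply: div_pow2_pos; rewrite /A; lra.
  have pB : 0 < B / 2 ^ S n by apply: div_pow2_pos; rewrite /B; lra.
  rewrite (boundary_int_split _ (fst p + A / 2 ^ S n) _ _ (snd p + B / 2 ^ S n)); try lra.
  move: k1 k2 k3 k4; rewrite /K. cbn [fst snd].
  rewrite sA sB -(Rplus_assoc (fst p)) -(Rplus_assoc (snd p)).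
  have -> : e / 4 ^ n = 4 * (e / 4 ^ S n) by simpl; field; apply: pow_nonzero; lra.
  move=> /Rabs_le_between k1 /Rabs_le_between k2 /Rabs_le_between k3 /Rabs_le_between k4.
  apply: Rle_not_lt. apply: Rabs_le. lra.
Qed.

Lemma quarter_pos n p :
  (fst p <= fst (quarter n p) /\ fst (quarter n p) + A / 2 ^ (S n) <= fst p + A / 2 ^ n) /\
  (snd p <= snd (quarter n p) /\ snd (quarter n p) + B / 2 ^ (S n) <= snd p + B / 2 ^ n).
Proof.
  have sA := div_pow2_half A n. have sB := div_pow2_half B n.
  have pA : 0 < A / 2 ^ S n by apply: div_pow2_pos; rewrite /A; lra.
  have pB : 0 < B / 2 ^ S n by apply: div_pow2_pos; rewrite /B; lra.
  rewrite /quarter. case: Rlt_dec => _ //=; last (case: Rlt_dec => _ //=; last case: Rlt_dec => _ //=); simpl in *; lra.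
Qed.

(** Goursat: otherwise nested bad rectangles of level n shrink to a point, and
    the differentiability at that point contradicts [boundary_int_local]. *)
Lemma boundary_int_small : Rabs (boundary_int P Q a b c d) <= e.
Proof.
  apply: Rnot_lt_le => hbad.
  have inv : forall n, a <= fst (corner n) /\ fst (corner n) + A / 2 ^ n <= b /\
     c <= snd (corner n) /\ snd (corner n) + B / 2 ^ n <= d /\ bad n (corner n).
  { elim=> [|n [i1 [i2 [i3 [i4 i5]]]]].
    - rewrite /bad /K /A /B /=. replace (a + (b - a) / 1) with b by field.
      replace (c + (d - c) / 1) with d by field. replace (e / 1) with e by field. repeat split; lra.
    - have := quarter_pos n (corner n). simpl corner => q.
      have := quarter_bad n (corner n) i1 i2 i3 i4 i5. repeat split; try lra. by []. }
  case: (nested_point (fun n => fst (corner n)) A) => [|n|x0 hx0]; first by rewrite /A; lra.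
  { by have := quarter_pos n (corner n); simpl corner => q; lra. }
  case: (nested_point (fun n => snd (corner n)) B) => [|n|y0 hy0]; first by rewrite /B; lra.
  { by have := quarter_pos n (corner n); simpl corner => q; lra. }
  have hAB : 0 < (A + B) ^ 2 by apply: pow_lt; rewrite /A /B; lra.
  have hx : a <= x0 <= b.
  { have := hx0 0%nat. have := inv 0%nat. lra. }
  have hy : c <= y0 <= d.
  { have := hy0 0%nat. have := inv 0%nat. lra. }
  (* The tolerance e / (A + B)^2 turns the local estimate on a rectangle of level n into e / 4^n. *)
  case: (boundary_int_local P Q x0 y0 (e / (A + B) ^ 2) (hcl _ _ hx hy)) => [|del [hdel H]].
  { by apply: Rdiv_lt_0_compat. }
  case: (pow2_unbounded ((A + B) / del)) => n hn.
  have p2 : 0 < 2 ^ n by apply: pow_lt; lra.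
  have hn' : (A + B) / 2 ^ n < del.
  { apply (Rmult_lt_reg_r (2 ^ n)) => //. replace ((A+B)/2^n*2^n) with (A+B) by (field; lra).
    apply (Rmult_lt_compat_r del) in hn => //. replace ((A+B)/del*del) with (A+B) in hn by (field; lra). lra. }
  have pA : 0 < A / 2 ^ n by apply: div_pow2_pos; rewrite /A; lra.
  have pB : 0 < B / 2 ^ n by apply: div_pow2_pos; rewrite /B; lra.
  have eAB : (A + B) / 2 ^ n = A / 2 ^ n + B / 2 ^ n by field; lra.
  case: (inv n) => i1 [i2 [i3 [i4 i5]]].
  have := H (fst (corner n)) (fst (corner n) + A / 2 ^ n) (snd (corner n)) (snd (corner n) + B / 2 ^ n)
    (hx0 n) (hy0 n) ltac:(lra) ltac:(lra).
  move=> /(_ (fun y hy' => ltac:(apply: ex_RInt_horizontal; lra))) /(_ (fun x hx' => ltac:(apply: ex_RInt_vertical; lra))).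
  apply: Rlt_not_le. move: i5; rewrite /bad /K.
  replace (e / (A + B) ^ 2 * (fst (corner n) + A / 2 ^ n - fst (corner n) + (snd (corner n) + B / 2 ^ n - snd (corner n))) ^ 2)
   with (e / 4 ^ n) => //.
  replace 4 with (2 * 2) by ring. rewrite Rpow_mult_distr. field. split; rewrite /A /B; lra.
Qed.
End Goursat.

Lemma goursat_green P Q a b c d : a < b -> c < d ->
  (forall x y, a <= x <= b -> c <= y <= d -> closed_at P Q x y) ->
  boundary_int P Q a b c d = 0.
Proof.
  move=> hab hcd h. apply: Rle_antisym.
  - apply: le_epsilon => e he. have := boundary_int_small P Q a b c d hab hcd h e he.
    move/Rabs_le_between; lra.
  - apply: Ropp_le_cancel. apply: le_epsilon => e he.
    have := boundary_int_small P Q a b c d hab hcd h e he.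
    move/Rabs_le_between; lra.
Qed.

(** * Circle integrals in logarithmic polar coordinates *)

Definition cexp (w : C) : C := (exp (fst w) * cos (snd w), exp (fst w) * sin (snd w)).

Lemma cexp_plus v w : cexp (v + w) = (cexp v * cexp w)%C.
Proof.
  rewrite /cexp. apply: injective_projections => /=; rewrite exp_plus ?cos_plus ?sin_plus; ring.
Qed.

Lemma Cmod_cexp w : Cmod (cexp w) = exp (fst w).
Proof.
  rewrite /Cmod /cexp /=. 
  replace (_ + _) with ((exp (fst w)) ^ 2 * (Rsqr (sin (snd w)) + Rsqr (cos (snd w)))) by (rewrite /Rsqr; ring).
  rewrite sin2_cos2 Rmult_1_r. apply: sqrt_pow2. apply: Rlt_le; exact: exp_pos.
Qed.

Lemma fst_le_Cmod w : Rabs (fst w) <= Cmod w.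
Proof. apply: Rle_trans (Rmax_Cmod w). exact: Rmax_l. Qed.
Lemma snd_le_Cmod w : Rabs (snd w) <= Cmod w.
Proof. apply: Rle_trans (Rmax_Cmod w). exact: Rmax_r. Qed.

Lemma Cmod_le_sum w : Cmod w <= Rabs (fst w) + Rabs (snd w).
Proof.
  rewrite /Cmod. apply: Rsqr_incr_0_var; last by have := Rabs_pos (fst w); have := Rabs_pos (snd w); lra.
  rewrite Rsqr_sqrt; last by have := pow2_ge_0 (fst w); have := pow2_ge_0 (snd w); lra.
  rewrite -(pow2_abs (fst w)) -(pow2_abs (snd w)) /Rsqr.
  have := Rabs_pos (fst w); have := Rabs_pos (snd w); nra.
Qed.

Lemma deriv_zero f l : derivable_pt_lim f 0 l -> forall e, 0 < e -> exists d, 0 < d /\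
  forall h, Rabs h < d -> Rabs (f h - f 0 - l * h) <= e * Rabs h.
Proof.
  move=> hf e he. case: (hf e he) => d hd. exists d; split; first exact: cond_pos.
  move=> h hh. case: (Req_dec h 0) => [->|h0].
  { rewrite Rmult_0_r Rminus_diag Rminus_0_r !Rabs_R0; lra. }
  have := hd h h0 hh. rewrite Rplus_0_l => k.
  replace (f h - f 0 - l * h) with (((f h - f 0) / h - l) * h) by (by field).
  rewrite Rabs_mult. apply: Rmult_le_compat_r; [exact: Rabs_pos | lra].
Qed.

(** The derivatives at 0 of the real functions exp, cos and sin suffice:
    e^s cos t - 1 - s = (e^s - 1 - s) + e^s (cos t - 1) and
    e^s sin t - t = e^s (sin t - t) + t (e^s - 1). *)
Lemma cdiff_cexp0 : cdiff cexp 0.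
Proof.
  apply: (cdiff_of_limit _ _ 1) => e0 he0.
  set e := Rmin 1 (e0 / 10).
  have he : 0 < e by apply: Rmin_pos; lra.
  have e1 : e <= 1 by exact: Rmin_l.
  have e2 : e <= e0 / 10 by exact: Rmin_r.
  have dcos : derivable_pt_lim cos 0 0.
  { have := derivable_pt_lim_cos 0. by rewrite sin_0 Ropp_0. }
  have dsin : derivable_pt_lim sin 0 1.
  { have := derivable_pt_lim_sin 0. by rewrite cos_0. }
  case: (deriv_zero _ _ (derivable_pt_lim_exp_0) e he) => d1 [hd1 h1].
  case: (deriv_zero _ _ dcos e he) => d2 [hd2 h2].
  case: (deriv_zero _ _ dsin e he) => d3 [hd3 h3].
  exists (Rmin e (Rmin d1 (Rmin d2 d3))); split; first by (do ?[apply: Rmin_pos]; lra).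
  move=> w. replace (w - 0)%C with w by ring. move=> hw.
  have m1 := Rmin_l e (Rmin d1 (Rmin d2 d3)). have m2 := Rmin_r e (Rmin d1 (Rmin d2 d3)).
  have m3 := Rmin_l d1 (Rmin d2 d3). have m4 := Rmin_r d1 (Rmin d2 d3).
  have m5 := Rmin_l d2 d3. have m6 := Rmin_r d2 d3.
  have fw := fst_le_Cmod w. have sw := snd_le_Cmod w.
  move: (h1 (fst w) ltac:(lra)) (h2 (snd w) ltac:(lra)) (h3 (snd w) ltac:(lra)).
  rewrite exp_0 cos_0 sin_0.
  set s := fst w in fw *. set t := snd w in sw *. set m := Cmod w in hw fw sw *.
  rewrite Rmult_0_l !Rminus_0_r !Rmult_1_l => k1 k2 k3.
  have m0 : 0 <= m by exact: Cmod_ge_0.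
  have es : exp s <= 3.
  { move/Rabs_le_between: k1. have := Rabs_pos s. have : Rabs s <= 1 by lra.
    move/Rabs_le_between. nra. }
  have ep := exp_pos s.
  apply: Rle_trans (Cmod_le_sum _) _.
  have -> : fst (cexp w - cexp 0 - 1 * w)%C = (exp s - 1 - s) + exp s * (cos t - 1).
  { rewrite /cexp /= exp_0 cos_0 -/s -/t; ring. }
  have -> : snd (cexp w - cexp 0 - 1 * w)%C = exp s * (sin t - t) + t * (exp s - 1).
  { rewrite /cexp /= exp_0 sin_0 -/s -/t; ring. }
  have b1 : Rabs (exp s - 1 - s) <= e * m by apply: Rle_trans k1 _; apply: Rmult_le_compat_l; lra.
  have b2 : Rabs (cos t - 1) <= e * m by apply: Rle_trans k2 _; apply: Rmult_le_compat_l; lra.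
  have b3 : Rabs (sin t - t) <= e * m by apply: Rle_trans k3 _; apply: Rmult_le_compat_l; lra.
  have b4 : Rabs (exp s - 1) <= 2 * e.
  { have := Rabs_triang (exp s - 1 - s) s. replace (exp s - 1 - s + s) with (exp s - 1) by ring.
    have : e * m <= 1 * m by apply: Rmult_le_compat_r; lra. lra. }
  have := Rabs_triang (exp s - 1 - s) (exp s * (cos t - 1)).
  have := Rabs_triang (exp s * (sin t - t)) (t * (exp s - 1)).
  rewrite !Rabs_mult (Rabs_pos_eq (exp s)); last lra.
  have c1 : exp s * Rabs (cos t - 1) <= 3 * (e * m).
  { apply: Rmult_le_compat => //; [lra | exact: Rabs_pos]. }
  have c2 : exp s * Rabs (sin t - t) <= 3 * (e * m).
  { apply: Rmult_le_compat => //; [lra | exact: Rabs_pos]. }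
  have c3 : Rabs t * Rabs (exp s - 1) <= m * (2 * e).
  { apply: Rmult_le_compat => //; exact: Rabs_pos. }
  have : e * m <= e0 / 10 * m by apply: Rmult_le_compat_r; lra.
  have : 0 <= e0 * m by apply: Rmult_le_pos; lra.
  lra.
Qed.

Lemma cdiff_cexp w : cdiff cexp w.
Proof.
  apply: (cdiff_ext (fun z => cexp w * cexp (z + - w))%C).
  { move=> z. rewrite -cexp_plus. congr cexp. ring. }
  apply: cdiff_mult; first exact: cdiff_const.
  apply: (cdiff_comp cexp (fun z => z + - w)%C).
  - apply: cdiff_plus; [exact: cdiff_id | exact: cdiff_const].
  - replace (w + - w)%C with (RtoC 0) by ring. exact: cdiff_cexp0.
Qed.

(** The Cauchy-Riemann equations; of the two only the one coupling the
    y-derivative of the real part to the x-derivative of the imaginary part is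
    recorded by [closed_at].  The other one comes from applying this to i G. *)
Lemma cdiff_closed G x y : cdiff G (x, y) ->
  closed_at (fun x y => fst (G (x, y))) (fun x y => snd (G (x, y))) x y.
Proof.
  move=> [g [hg eg]].
  set l := g (x, y).
  have key : forall eps : posreal, exists d : posreal, forall u v, Rabs (u - x) < d -> Rabs (v - y) < d ->
     Cmod (G (u, v) - G (x, y) - l * ((u, v) - (x, y))) <= eps * Rmax (Rabs (u - x)) (Rabs (v - y)).
  { move=> eps. have he : 0 < eps / 2 by have := cond_pos eps; lra.
    case: (hg _ he) => d [hd h]. have hd2 : 0 < d / 2 by lra. exists (mkposreal _ hd2) => u v hu hv.
    rewrite eg. simpl in hu, hv.
    replace (g (u, v) * ((u, v) - (x, y)) - l * ((u, v) - (x, y)))%C with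
      ((g (u,v) - l) * ((u, v) - (x, y)))%C by ring.
    rewrite Cmod_mult.
    have hm : Cmod ((u, v) - (x, y)) <= 2 * Rmax (Rabs (u - x)) (Rabs (v - y)).
    { apply: Rle_trans (Cmod_le_sum _) _. rewrite /=.
      have := Rmax_l (Rabs (u - x)) (Rabs (v - y)). have := Rmax_r (Rabs (u - x)) (Rabs (v - y)).
      rewrite /Rminus; lra. }
    have hm2 : Cmod ((u, v) - (x, y)) < d.
    { apply: Rle_lt_trans (Cmod_le_sum _) _. rewrite /= -/(Rminus u x) -/(Rminus v y). lra. }
    have := h _ hm2. rewrite -/l => hk.
    have : Cmod (g (u, v) - l) * Cmod ((u, v) - (x, y)) <= eps / 2 * (2 * Rmax (Rabs (u - x)) (Rabs (v - y))).
    { apply: Rmult_le_compat; try exact: Cmod_ge_0; lra. }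
    lra. }
  exists (fst l), (- snd l), (snd l), (fst l).
  split; last (split; last lra).
  - move=> eps. case: (key eps) => d h. exists d => u v hu hv. apply: Rle_trans (h u v hu hv).
    apply: Rle_trans (fst_le_Cmod _). apply: Req_le. congr Rabs. rewrite /=. ring.
  - move=> eps. case: (key eps) => d h. exists d => u v hu hv. apply: Rle_trans (h u v hu hv).
    apply: Rle_trans (snd_le_Cmod _). apply: Req_le. congr Rabs. rewrite /=. ring.
Qed.

(** By periodicity the two horizontal sides of the rectangle
    [a, b] x [0, 2 pi] cancel in the Goursat theorem. *)
Lemma strip_snd_const G a b : a < b ->
  (forall x y, a <= x <= b -> cdiff G (x, y)) ->
  (forall x y, G (x, y + 2 * PI) = G (x, y)) ->
  RInt (fun t => snd (G (b, t))) 0 (2 * PI) = RInt (fun t => snd (G (a, t))) 0 (2 * PI).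
Proof.
  move=> hab hG per. have pi := PI_RGT_0.
  have := goursat_green (fun x y => fst (G (x, y))) (fun x y => snd (G (x, y))) a b 0 (2 * PI) hab
   ltac:(lra) (fun x y hx _ => cdiff_closed G x y (hG x y hx)).
  rewrite /boundary_int.
  rewrite (RInt_ext (fun x => fst (G (x, 2 * PI))) (fun x => fst (G (x, 0)))); first lra.
  move=> x _. by rewrite -(per x 0) Rplus_0_l.
Qed.

Definition circ (r t : R) : C := (r * cos t, r * sin t).

(** The contour integral of H(w) / (i w) dw over |w| = r, which is 2 pi times the
    mean of H on that circle. *)
Definition circle_int (H : C -> C) (r : R) : C :=
  (RInt (fun t => fst (H (circ r t))) 0 (2 * PI), RInt (fun t => snd (H (circ r t))) 0 (2 * PI)).

Lemma Cmod_circ r t : 0 <= r -> Cmod (circ r t) = r.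
Proof.
  move=> hr. rewrite /Cmod /circ /=.
  replace (_ + _) with (r ^ 2 * (Rsqr (sin t) + Rsqr (cos t))) by (rewrite /Rsqr; ring).
  rewrite sin2_cos2 Rmult_1_r. exact: sqrt_pow2.
Qed.

(** In the coordinates w = exp(s + i t) concentric circles become the vertical
    segments of a periodic strip, so [strip_snd_const] applies to H o exp; the
    real part is the imaginary part for i H. *)
Lemma circle_int_annulus H r1 r2 : 0 < r1 -> r1 <= r2 ->
  (forall w, r1 <= Cmod w <= r2 -> cdiff H w) -> circle_int H r1 = circle_int H r2.
Proof.
  move=> h1 [h2|->] // hH.
  have cx : forall r t, 0 < r -> cexp (ln r, t) = circ r t.
  { move=> r t hr. by rewrite /cexp /circ /= exp_ln. }
  have hln : ln r1 < ln r2 by exact: ln_increasing.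
  have hc : forall x y, ln r1 <= x <= ln r2 -> r1 <= Cmod (cexp (x, y)) <= r2.
  { move=> x y hx. rewrite Cmod_cexp /=. rewrite -{1}(exp_ln r1) // -{1}(exp_ln r2); last lra.
    have e1 : forall u v, u <= v -> exp u <= exp v.
    { move=> u v [h|->]; [apply: Rlt_le; exact: exp_increasing | lra]. }
    split; apply: e1; simpl in *; lra. }
  have dG : forall x y, ln r1 <= x <= ln r2 -> cdiff (fun w => H (cexp w)) (x, y).
  { move=> x y hx. apply: (cdiff_comp H cexp); first exact: cdiff_cexp. apply: hH. exact: hc. }
  have per : forall x y, cexp (x, y + 2 * PI) = cexp (x, y).
  { move=> x y. rewrite /cexp /=. by rewrite cos_plus sin_plus cos_2PI sin_2PI !Rmult_1_r !Rmult_0_r Rminus_0_r Rplus_0_r. }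
  apply: injective_projections => /=.
  - have := strip_snd_const (fun w => Ci * H (cexp w))%C _ _ hln.
    move=> /(_ (fun x y hx => cdiff_mult _ _ _ (cdiff_const Ci _) (dG x y hx))).
    move=> /(_ (fun x y => f_equal (fun z => Ci * H z)%C (per x y))) => e.
    transitivity (RInt (fun t : R => snd (Ci * H (cexp (ln r1, t)))%C) 0 (2 * PI)).
    { apply: RInt_ext => t _. rewrite cx //=. ring. }
    rewrite -e. apply: RInt_ext => t _. rewrite cx; [rewrite /=; ring | lra].
  - have := strip_snd_const (fun w => H (cexp w))%C _ _ hln dG.
    move=> /(_ (fun x y => f_equal H (per x y))) => e.
    transitivity (RInt (fun t : R => snd (H (cexp (ln r1, t)))%C) 0 (2 * PI)).
    { apply: RInt_ext => t _. by rewrite cx. }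
    rewrite -e. apply: RInt_ext => t _. rewrite cx //; lra.
Qed.

(** * Elementary properties of circle integrals *)

Lemma circ_cont r t e : 0 < e -> exists d, 0 < d /\ forall r' t',
  Rabs (r' - r) < d -> Rabs (t' - t) < d -> Cmod (circ r' t' - circ r t) < e.
Proof.
  move=> he. have he2 : 0 < e / 2 by lra.
  have h1 : continuity_2d_pt (fun r t => r * cos t) r t.
  { apply: continuity_2d_pt_mult; first exact: continuity_2d_pt_id1.
    apply: continuity_1d_2d_pt_comp; [exact: continuity_cos | exact: continuity_2d_pt_id2]. }
  have h2 : continuity_2d_pt (fun r t => r * sin t) r t.
  { apply: continuity_2d_pt_mult; first exact: continuity_2d_pt_id1.
    apply: continuity_1d_2d_pt_comp; [exact: continuity_sin | exact: continuity_2d_pt_id2]. }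
  case: (h1 (mkposreal _ he2)) => d1 k1. case: (h2 (mkposreal _ he2)) => d2 k2.
  exists (Rmin d1 d2); split; first by apply: Rmin_pos; exact: cond_pos.
  move=> r' t' hr ht. have m1 := Rmin_l d1 d2. have m2 := Rmin_r d1 d2.
  apply: Rle_lt_trans (Cmod_le_sum _) _.
  have := k1 r' t' ltac:(lra) ltac:(lra). have := k2 r' t' ltac:(lra) ltac:(lra).
  simpl. rewrite /Rminus. lra.
Qed.

Lemma ccont_circ_2d H r t : ccont H (circ r t) ->
  continuity_2d_pt (fun r t => fst (H (circ r t))) r t /\
  continuity_2d_pt (fun r t => snd (H (circ r t))) r t.
Proof.
  move=> hH; split => eps; case: (hH eps (cond_pos eps)) => d [hd h];
   case: (circ_cont r t d hd) => d' [hd' h']; exists (mkposreal _ hd') => r' t' hr ht.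
  - apply: Rle_lt_trans (h _ (h' r' t' hr ht)). exact: (fst_le_Cmod (H (circ r' t') - H (circ r t))%C).
  - apply: Rle_lt_trans (h _ (h' r' t' hr ht)). exact: (snd_le_Cmod (H (circ r' t') - H (circ r t))%C).
Qed.

Definition cont_circle (H : C -> C) (r : R) := forall w, Cmod w = r -> ccont H w.

Lemma ex_circle_int H r : 0 <= r -> cont_circle H r ->
  ex_RInt (fun t => fst (H (circ r t))) 0 (2 * PI) /\ ex_RInt (fun t => snd (H (circ r t))) 0 (2 * PI).
Proof.
  move=> hr hH; split; apply: ex_RInt_continuous => t _; apply/filterlim_locally => eps;
  case: (ccont_circ_2d H r t (hH _ (Cmod_circ r t hr))) => h1 h2.
  - case: (h1 eps) => d h. exists d => t' ht'. apply: h => //. rewrite Rminus_diag Rabs_R0; exact: cond_pos.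
  - case: (h2 eps) => d h. exists d => t' ht'. apply: h => //. rewrite Rminus_diag Rabs_R0; exact: cond_pos.
Qed.

Lemma circle_int_ext H1 H2 r : 0 <= r -> (forall w, Cmod w = r -> H1 w = H2 w) -> circle_int H1 r = circle_int H2 r.
Proof.
  move=> hr h. rewrite /circle_int. by congr pair; apply: RInt_ext => t _; rewrite h // Cmod_circ.
Qed.

Lemma circle_int_const c r : circle_int (fun _ => c) r = (RtoC (2 * PI) * c)%C.
Proof.
  rewrite /circle_int !RInt_const. apply: injective_projections; rewrite /= /scal /= /mult /=; ring.
Qed.

Lemma circle_int_plus H1 H2 r : 0 <= r -> cont_circle H1 r -> cont_circle H2 r ->
  circle_int (fun w => H1 w + H2 w)%C r = (circle_int H1 r + circle_int H2 r)%C.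
Proof.
  move=> hr c1 c2. case: (ex_circle_int _ _ hr c1) => a1 a2. case: (ex_circle_int _ _ hr c2) => b1 b2.
  apply: injective_projections => /=; exact: (RInt_plus (V:=R_CompleteNormedModule)).
Qed.

Lemma circle_int_scal c H r : 0 <= r -> cont_circle H r -> circle_int (fun w => c * H w)%C r = (c * circle_int H r)%C.
Proof.
  move=> hr c1. case: (ex_circle_int _ _ hr c1) => a1 a2.
  have s : forall k f, ex_RInt f 0 (2*PI) -> is_RInt (fun t : R => k * f t) 0 (2 * PI) (k * RInt f 0 (2 * PI)).
  { move=> k f hf. apply: (@is_RInt_scal R_NormedModule). exact: RInt_correct. }
  apply: injective_projections => /=; apply: is_RInt_unique.
  - apply: (@is_RInt_minus R_NormedModule); exact: s.
  - apply: (@is_RInt_plus R_NormedModule); exact: s.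
Qed.

(** The constant is twice the optimal one, since the two components are
    estimated separately. *)
Lemma circle_int_bound H r M : 0 <= r -> cont_circle H r ->
  (forall t, 0 <= t <= 2 * PI -> Cmod (H (circ r t)) <= M) -> Cmod (circle_int H r) <= 4 * PI * M.
Proof.
  move=> hr c1 hM. case: (ex_circle_int _ _ hr c1) => a1 a2. have pi := PI_RGT_0.
  apply: Rle_trans (Cmod_le_sum _) _. rewrite /circle_int; cbn [fst snd].
  have b1 : Rabs (RInt (fun t => fst (H (circ r t))) 0 (2 * PI)) <= (2 * PI - 0) * M.
  { apply: abs_RInt_le_const => //; first lra. move=> t ht. apply: Rle_trans (fst_le_Cmod _) _.
    exact: hM. }
  have b2 : Rabs (RInt (fun t => snd (H (circ r t))) 0 (2 * PI)) <= (2 * PI - 0) * M.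
  { apply: abs_RInt_le_const => //; first lra. move=> t ht. apply: Rle_trans (snd_le_Cmod _) _.
    exact: hM. }
  lra.
Qed.

Lemma circle_bounded H r : 0 <= r -> cont_circle H r ->
  exists M, forall t, 0 <= t <= 2 * PI -> Cmod (H (circ r t)) <= M.
Proof.
  move=> hr hH. have pi := PI_RGT_0.
  have cc : forall t, 0 <= t <= 2 * PI -> continuity_pt (fun t => Cmod (H (circ r t))) t.
  { move=> t _. apply/continuity_pt_filterlim/filterlim_locally => eps.
    case: (hH _ (Cmod_circ r t hr) eps (cond_pos eps)) => d [hd h].
    case: (circ_cont r t d hd) => d' [hd' h']. exists (mkposreal _ hd') => t' ht.
    have hh : Cmod (circ r t' - circ r t) < d.
    { apply: h' => //. rewrite Rminus_diag Rabs_R0 //. }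
    have := h _ hh. change (Cmod (H (circ r t') - H (circ r t)) < eps ->
      Rabs (Cmod (H (circ r t')) - Cmod (H (circ r t))) < eps).
    have := Cmod_rev (H (circ r t)) (H (circ r t')). have := Cmod_rev (H (circ r t')) (H (circ r t)).
    rewrite (Cmod_sub_sym (H (circ r t)) (H (circ r t'))). move=> *. apply: Rabs_def1; lra. }
  case: (continuity_ab_maj _ 0 (2 * PI) ltac:(lra) cc) => tM [hM _].
  exists (Cmod (H (circ r tM))) => t ht; exact: hM.
Qed.

Lemma circle_int_cont H r0 : (forall w, ccont H w) -> 0 <= r0 -> forall e, 0 < e -> exists d, 0 < d /\
  forall r, 0 <= r -> Rabs (r - r0) < d -> Cmod (circle_int H r - circle_int H r0) < e.
Proof.
  move=> hH hr0 e he. have pi := PI_RGT_0.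
  have he2 : 0 < e / (8 * PI) by apply: Rdiv_lt_0_compat; lra.
  have cc : forall r, 0 <= r -> cont_circle H r by move=> r _ w _; exact: hH.
  case: (uniform_continuity_2d (fun r t => fst (H (circ r t))) 0 (r0 + 1) 0 (2 * PI)
    (fun r t _ _ => proj1 (ccont_circ_2d H r t (hH _))) (mkposreal _ he2)) => d1 h1.
  case: (uniform_continuity_2d (fun r t => snd (H (circ r t))) 0 (r0 + 1) 0 (2 * PI)
    (fun r t _ _ => proj2 (ccont_circ_2d H r t (hH _))) (mkposreal _ he2)) => d2 h2.
  exists (Rmin 1 (Rmin d1 d2)); split.
  { by repeat (apply: Rmin_pos => //); try exact: cond_pos; lra. }
  move=> r hr hd. have m1 := Rmin_l 1 (Rmin d1 d2). have m2 := Rmin_r 1 (Rmin d1 d2).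
  have m3 := Rmin_l d1 d2. have m4 := Rmin_r d1 d2.
  have hr1 : r <= r0 + 1.
  { have : Rabs (r - r0) < 1 by lra. move/Rabs_lt_between; lra. }
  case: (ex_circle_int _ _ hr (cc r hr)) => a1 a2. case: (ex_circle_int _ _ hr0 (cc r0 hr0)) => b1 b2.
  apply: Rle_lt_trans (Cmod_le_sum _) _. rewrite /circle_int; cbn [fst snd Cminus Cplus Copp].
  rewrite -!/(Rminus _ _).
  have k1 : Rabs (RInt (fun t => fst (H (circ r t))) 0 (2 * PI) - RInt (fun t => fst (H (circ r0 t))) 0 (2 * PI))
     <= (2 * PI - 0) * (e / (8 * PI)).
  { have I := @is_RInt_minus R_NormedModule _ _ _ _ _ _ (RInt_correct _ _ _ a1) (RInt_correct _ _ _ b1).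
    rewrite -(is_RInt_unique _ _ _ _ I : _ = _ - _). apply: abs_RInt_le_const; first lra.
    - by eexists; exact: I.
    - move=> t ht. apply: Rlt_le. apply: (h1 r0 t r t); try lra. rewrite Rminus_diag Rabs_R0; exact: cond_pos. }
  have k2 : Rabs (RInt (fun t => snd (H (circ r t))) 0 (2 * PI) - RInt (fun t => snd (H (circ r0 t))) 0 (2 * PI))
     <= (2 * PI - 0) * (e / (8 * PI)).
  { have I := @is_RInt_minus R_NormedModule _ _ _ _ _ _ (RInt_correct _ _ _ a2) (RInt_correct _ _ _ b2).
    rewrite -(is_RInt_unique _ _ _ _ I : _ = _ - _). apply: abs_RInt_le_const; first lra.
    - by eexists; exact: I.
    - move=> t ht. apply: Rlt_le. apply: (h2 r0 t r t); try lra. rewrite Rminus_diag Rabs_R0; exact: cond_pos. }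
  have e4 : (2 * PI - 0) * (e / (8 * PI)) = e / 4 by field; lra.
  lra.
Qed.

(** As a function of r the integral is continuous, and it is constant on each
    side of |z| by [circle_int_annulus]; so it keeps the value at r = 0. *)
Lemma circle_int_one_exception H z r : (forall w, ccont H w) -> (forall w, w <> z -> cdiff H w) ->
  0 <= r -> circle_int H r = circle_int H 0.
Proof.
  move=> hH hd hr.
  have step : forall a b, 0 <= a -> a < b -> (b <= Cmod z \/ Cmod z <= a) -> circle_int H b = circle_int H a.
  { move=> a b ha hab hz.
    have cst : forall x y, a < x -> x <= y -> y < b -> circle_int H x = circle_int H y.
    { move=> x y h1 h2 h3. apply: circle_int_annulus => //; first lra. move=> w hw. apply: hd => e.
      rewrite e in hw; lra. }
    have : Cmod (circle_int H b - circle_int H a) <= 0.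
    { apply: le_epsilon => e he. rewrite Rplus_0_l.
      case: (circle_int_cont H a hH ha (e/2)) => [|d1 [hd1 k1]]; first lra.
      case: (circle_int_cont H b hH ltac:(lra) (e/2)) => [|d2 [hd2 k2]]; first lra.
      have : exists d, 0 < d /\ d < d1 /\ d < d2 /\ d < (b - a) / 2.
      { exists (Rmin (Rmin d1 d2) (b - a) / 3).
        have m1 := Rmin_l (Rmin d1 d2) (b-a). have m2 := Rmin_r (Rmin d1 d2) (b-a).
        have m3 := Rmin_l d1 d2. have m4 := Rmin_r d1 d2.
        have : 0 < Rmin (Rmin d1 d2) (b-a) by (do ?[apply: Rmin_pos]; lra). lra. }
      move=> [d [p0 [p1 [p2 p3]]]].
      have q1 := k1 (a + d) ltac:(lra) ltac:(apply: Rabs_def1; lra).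
      have q2 := k2 (b - d) ltac:(lra) ltac:(apply: Rabs_def1; lra).
      have e1 : circle_int H (a + d) = circle_int H (b - d) by apply: cst; lra.
      rewrite e1 in q1.
      have := Cmod_triangle (circle_int H (b - d) - circle_int H a) (circle_int H b - circle_int H (b - d)).
      replace (circle_int H (b - d) - circle_int H a + (circle_int H b - circle_int H (b - d)))%C with (circle_int H b - circle_int H a)%C by ring.
      rewrite (Cmod_sub_sym (circle_int H b) (circle_int H (b - d))). lra. }
    have := Cmod_ge_0 (circle_int H b - circle_int H a) => h1 h2.
    have : Cmod (circle_int H b - circle_int H a) = 0 by lra. move/Cmod_eq_0 => e.
    replace (circle_int H b) with (circle_int H b - circle_int H a + circle_int H a)%C by ring. rewrite e; ring. }
  have z0 := Cmod_ge_0 z.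
  have base : forall b, 0 <= b <= Cmod z -> circle_int H b = circle_int H 0.
  { move=> b [[hb|<-] hb2] //. apply: step; lra. }
  case: (Rle_dec r (Cmod z)) => h; first by apply: base.
  rewrite (step (Cmod z) r); [by apply: base; lra | lra | lra | lra].
Qed.

(** * The Cauchy formula and Taylor expansions of entire functions *)

Lemma cdiff_kernel z w : w <> z -> cdiff (fun w => w / (w - z))%C w.
Proof.
  move=> h. apply: cdiff_mult; first exact: cdiff_id.
  apply: cdiff_inv; first by apply: cdiff_minus; [exact: cdiff_id | exact: cdiff_const].
  move=> e; apply: h. replace w with (w - z + z)%C by ring. rewrite e; ring.
Qed.

Lemma Cneq_Cmod (w z : C) : Cmod z < Cmod w -> w <> z.
Proof. move=> h e. rewrite e in h. lra. Qed.

Lemma Cminus_neq_0 (w z : C) : w <> z -> (w - z)%C <> 0.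
Proof. move=> h e; apply: h. replace w with (w - z + z)%C by ring. rewrite e; ring. Qed.

Lemma Cmod_inv_kernel z w r : Cmod w = r -> Cmod z < r -> Cmod (/ (w - z)) <= / (r - Cmod z).
Proof.
  move=> hw hz. rewrite Cmod_inv; last by apply: Cminus_neq_0; apply: Cneq_Cmod; lra.
  apply: Rinv_le_contravar; first lra.
  have := Cmod_rev w z. rewrite (Cmod_sub_sym z w). lra.
Qed.

(** The integral does not depend on r, and w / (w - z) - 1 = z / (w - z) tends
    to 0 uniformly on large circles. *)
Lemma circle_int_kernel z r : Cmod z < r -> circle_int (fun w => w / (w - z))%C r = RtoC (2 * PI).
Proof.
  move=> hz. have z0 := Cmod_ge_0 z. have pi := PI_RGT_0.
  have : Cmod (circle_int (fun w => w / (w - z))%C r - RtoC (2 * PI)) <= 0.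
  { apply: le_epsilon => e he. rewrite Rplus_0_l.
    (* On this radius the bound 4 pi |z| / (R - |z|) is at most e. *)
    set R := r + 4 * PI * Cmod z / e.
    have hR : r <= R.
    { rewrite /R. have : 0 <= 4 * PI * Cmod z / e by apply: Rdiv_le_0_compat => //; nra. lra. }
    rewrite (circle_int_annulus _ r R) //; first last.
    { move=> w hw. apply: cdiff_kernel. apply: Cneq_Cmod; lra. }
    { lra. }
    have cz : cont_circle (fun w => z * / (w - z))%C R.
    { move=> w hw. apply: ccont_mult; first exact: ccont_const.
      apply: ccont_inv; last by apply: Cminus_neq_0; apply: Cneq_Cmod; lra.
      apply: ccont_minus; [exact: ccont_id | exact: ccont_const]. }
    have -> : (circle_int (fun w => w / (w - z))%C R - RtoC (2 * PI))%C = circle_int (fun w => z * / (w - z))%C R.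
    { rewrite (circle_int_ext _ (fun w => 1 + z * / (w - z))%C R); first last.
      { move=> w hw. field. apply: Cminus_neq_0; apply: Cneq_Cmod; lra. }
      { lra. }
      rewrite circle_int_plus //; [rewrite circle_int_const; ring | lra | by move=> w _; exact: ccont_const]. }
    apply: Rle_trans (circle_int_bound _ R (Cmod z * / (R - Cmod z)) _ cz _) _; first lra.
    - move=> t _. rewrite Cmod_mult. apply: Rmult_le_compat_l => //.
      apply: Cmod_inv_kernel; last lra. apply: Cmod_circ; lra.
    - apply (Rmult_le_reg_r (R - Cmod z)); first lra.
      replace (4 * PI * (Cmod z * / (R - Cmod z)) * (R - Cmod z)) with (4 * PI * Cmod z) by (field; lra).
      have -> : e * (R - Cmod z) = e * (r - Cmod z) + 4 * PI * Cmod z by rewrite /R; field; lra.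
      nra. }
  have := Cmod_ge_0 (circle_int (fun w => w / (w - z))%C r - RtoC (2 * PI)) => h1 h2.
  have : Cmod (circle_int (fun w => w / (w - z))%C r - RtoC (2 * PI)) = 0 by lra.
  move/Cmod_eq_0 => e.
  replace (circle_int (fun w => w / (w - z))%C r) with (circle_int (fun w => w / (w - z))%C r - RtoC (2 * PI) + RtoC (2 * PI))%C by ring.
  rewrite e; ring.
Qed.

Section Entire.
Variable F : C -> C.
Hypothesis hF : forall w, cdiff F w.

Lemma F_cont w : ccont F w.
Proof. exact: cdiff_cont. Qed.

(** The function w (F(w) - F(z)) / (w - z), extended continuously to z, is
    differentiable off z and vanishes at 0; [circle_int_one_exception] kills its
    integral, and [circle_int_kernel] evaluates the remaining term. *)
Lemma cauchy_formula z r : Cmod z < r ->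
  circle_int (fun w => F w * (w / (w - z)))%C r = (RtoC (2 * PI) * F z)%C.
Proof.
  move=> hz. have z0 := Cmod_ge_0 z. case: (hF z) => g [hg eg].
  have ck : cont_circle (fun w => w / (w - z))%C r.
  { move=> w hw. apply: cdiff_cont. apply: cdiff_kernel. apply: Cneq_Cmod; lra. }
  have gd : forall w, w <> z -> cdiff g w.
  { move=> w hw. have nz := Cminus_neq_0 _ _ hw.
    apply: (cdiff_loc (fun w => (F w - F z) / (w - z))%C _ _ (Cmod (w - z))); first by apply/Cmod_gt_0.
    - move=> w' hw'. rewrite eg. field. apply: Cminus_neq_0 => e. rewrite e (Cmod_sub_sym z w) in hw'. lra.
    - apply: cdiff_mult; first by apply: cdiff_minus => //; exact: cdiff_const.
      apply: cdiff_inv => //. apply: cdiff_minus; [exact: cdiff_id | exact: cdiff_const]. }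
  have gc : forall w, ccont g w.
  { move=> w. case: (Ceq_dec w z) => [->|hw] //. apply: cdiff_cont. exact: gd. }
  have z1 := circle_int_one_exception (fun w => w * g w)%C z r.
  rewrite (circle_int_ext (fun w => w * g w)%C (fun _ => RtoC 0) 0) in z1; first last.
  { move=> w /Cmod_eq_0 ->. ring. }
  { lra. }
  rewrite circle_int_const in z1.
  have {}z1 : circle_int (fun w => w * g w)%C r = 0.
  { rewrite z1; [ring | | | lra].
    - move=> w. apply: ccont_mult => //. exact: ccont_id.
    - move=> w hw. apply: cdiff_mult; [exact: cdiff_id | exact: gd]. }
  have : circle_int (fun w => F w * (w / (w - z)))%C r = 
    (circle_int (fun w => w * g w) r + F z * circle_int (fun w => w / (w - z)) r)%C.
  { rewrite -circle_int_scal //; last lra. rewrite -circle_int_plus; first last.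
    - move=> w hw. apply: ccont_mult; [exact: ccont_const | exact: ck].
    - move=> w hw. apply: ccont_mult; [exact: ccont_id | exact: gc].
    - lra.
    - apply: circle_int_ext; first lra. move=> w hw.
      have hn : (w - z)%C <> 0 by apply: Cminus_neq_0; apply: Cneq_Cmod; lra.
      replace (g w) with ((F w - F z) / (w - z))%C; last by rewrite eg; field.
      field. exact: hn. }
  rewrite z1 circle_int_kernel // => ->. ring.
Qed.

Definition taylor_coef (k : nat) : C := (/ RtoC (2 * PI) * circle_int (fun w => F w * / w ^ k)%C 1)%C.

Lemma twopi_nz : RtoC (2 * PI) <> 0.
Proof. move=> h. have := PI_RGT_0. move: h => /(f_equal fst) /=; lra. Qed.

Lemma cdiff_div_pow k (w : C) : w <> 0 -> cdiff (fun w => F w * / w ^ k)%C w.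
Proof.
  move=> h. apply: cdiff_mult => //. apply: cdiff_inv; last exact: Cpow_nz.
  apply: cdiff_pow. exact: cdiff_id.
Qed.

Lemma taylor_coef_any k r : 0 < r -> circle_int (fun w => F w * / w ^ k)%C r = (RtoC (2 * PI) * taylor_coef k)%C.
Proof.
  move=> hr. rewrite /taylor_coef.
  have <- : circle_int (fun w => F w * / w ^ k)%C r = circle_int (fun w => F w * / w ^ k)%C 1.
  { case: (Rle_dec r 1) => h; [|symmetry]; apply: circle_int_annulus; try lra; move=> w hw; apply: cdiff_div_pow;
     apply: Cneq_Cmod; rewrite Cmod_0; lra. }
  field. move=> [] h. apply: twopi_nz. by rewrite RtoC_mult; apply: injective_projections => /=; lra.
Qed.

Fixpoint csum (c : nat -> C) (n : nat) : C :=
  match n with O => 0 | S k => (csum c k + c k)%C end.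

(** Iterate w / (w - z) = 1 + (z / w) (w / (w - z)) under the integral of the
    Cauchy formula. *)
Lemma taylor_remainder z r n : Cmod z < r ->
  (F z - csum (fun k => taylor_coef k * z ^ k) n)%C =
  (/ RtoC (2 * PI) * z ^ n * circle_int (fun w => F w * / w ^ n * (w / (w - z))) r)%C.
Proof.
  move=> hz. have z0 := Cmod_ge_0 z.
  elim: n => [|n IH] /=.
  { rewrite (circle_int_ext _ (fun w => F w * (w / (w - z)))%C); [|lra|].
    - rewrite cauchy_formula //. field. exact: twopi_nz.
    - move=> w hw. field. apply: Cminus_neq_0; apply: Cneq_Cmod; lra. }
  have -> : (F z - (csum (fun k => taylor_coef k * z ^ k) n + taylor_coef n * z ^ n) =
    (F z - csum (fun k => taylor_coef k * z ^ k) n) - taylor_coef n * z ^ n)%C by ring.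
  rewrite IH.
  have hnz : forall w, Cmod w = r -> w <> 0 /\ w <> z.
  { move=> w hw. split; apply: Cneq_Cmod; rewrite ?Cmod_0; lra. }
  have c1 : cont_circle (fun w => F w * / (w * w ^ n) * (w / (w - z)))%C r.
  { move=> w hw. case: (hnz w hw) => h1 h2. apply: cdiff_cont. apply: cdiff_mult; last exact: cdiff_kernel.
    exact: (cdiff_div_pow (S n)). }
  have -> : circle_int (fun w => F w * / w ^ n * (w / (w - z)))%C r =
    (circle_int (fun w => F w * / w ^ n) r + z * circle_int (fun w => F w * / (w * w ^ n) * (w / (w - z))) r)%C.
  { rewrite -circle_int_scal //; last lra. rewrite -circle_int_plus; [|lra| |].
    - apply: circle_int_ext; first lra. move=> w hw. case: (hnz w hw) => h1 h2. field.
      split; [exact: Cminus_neq_0 | split => //; exact: Cpow_nz].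
    - move=> w hw. case: (hnz w hw) => h1 h2. apply: cdiff_cont. exact: cdiff_div_pow.
    - move=> w hw. apply: ccont_mult; [exact: ccont_const | exact: c1]. }
  rewrite taylor_coef_any; last lra. field. exact: twopi_nz.
Qed.

(** The constant M depends on the radius r but not on n: small z gives the
    asymptotic expansion of each order at 0, while n tending to infinity
    identifies F with a polynomial once the coefficients vanish eventually. *)
Lemma taylor r : 0 < r -> exists M, forall n z, Cmod z <= r / 2 ->
  Cmod (F z - csum (fun k => taylor_coef k * z ^ k)%C n) <= M * (Cmod z / r) ^ n.
Proof.
  move=> hr. have pi := PI_RGT_0.
  case: (circle_bounded F r) => [||M hM]; [lra | by move=> w _; exact: F_cont |].
  have M0 : 0 <= M.
  { have := hM 0 ltac:(lra). have := Cmod_ge_0 (F (circ r 0)); lra. }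
  exists (4 * M) => n z hz. have z0 := Cmod_ge_0 z.
  rewrite (taylor_remainder z r); last lra.
  rewrite !Cmod_mult Cmod_pow.
  have -> : Cmod (/ RtoC (2 * PI)) = / (2 * PI).
  { rewrite Cmod_inv; last exact: twopi_nz. rewrite Cmod_R Rabs_pos_eq; lra. }
  have hnz : forall w, Cmod w = r -> w <> 0 /\ w <> z.
  { move=> w hw. split; apply: Cneq_Cmod; rewrite ?Cmod_0; lra. }
  have rn : 0 < r ^ n by exact: pow_lt.
  have B : Cmod (circle_int (fun w => F w * / w ^ n * (w / (w - z))) r)%C <= 4 * PI * (M * / r ^ n * 2).
  { apply: circle_int_bound; first lra.
    - move=> w hw. case: (hnz w hw) => h1 h2. apply: cdiff_cont. apply: cdiff_mult; last exact: cdiff_kernel.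
      exact: cdiff_div_pow.
    - move=> t ht. have hc := Cmod_circ r t (Rlt_le _ _ hr). case: (hnz _ hc) => h1 h2.
      rewrite !Cmod_mult Cmod_inv; last exact: Cpow_nz. rewrite Cmod_pow hc.
      have k : Cmod (/ (circ r t - z)) <= 2 / r.
      { apply: Rle_trans (Cmod_inv_kernel _ _ _ hc _) _; first lra.
        replace (2 / r) with (/ (r / 2)) by (field; lra). apply: Rinv_le_contravar; lra. }
      apply: Rmult_le_compat.
      + apply: Rmult_le_pos; [exact: Cmod_ge_0 | apply: Rlt_le; exact: Rinv_0_lt_compat].
      + apply: Rmult_le_pos; [lra | exact: Cmod_ge_0].
      + apply: Rmult_le_compat_r; [apply: Rlt_le; exact: Rinv_0_lt_compat | exact: hM].
      + replace 2 with (r * (2 / r)) by (field; lra). apply: Rmult_le_compat_l; lra. }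
  have e : 4 * M * (Cmod z / r) ^ n = / (2 * PI) * Cmod z ^ n * (4 * PI * (M * / r ^ n * 2)).
  { rewrite /Rdiv Rpow_mult_distr pow_inv. field. lra. }
  rewrite e. apply: Rmult_le_compat_l => //. apply: Rmult_le_pos; last exact: pow_le.
  apply: Rlt_le; apply: Rinv_0_lt_compat; lra.
Qed.
End Entire.

(** * Odd expansions of real odd entire functions *)

Lemma csum_ext c c' n : (forall k, c k = c' k) -> csum c n = csum c' n.
Proof. by move=> h; elim: n => [|n /= ->] //; rewrite h. Qed.

Lemma csum_minus c c' n : csum (fun k => c k - c' k)%C n = (csum c n - csum c' n)%C.
Proof. elim: n => [|n IH] /=; [ring | rewrite IH; ring]. Qed.

Lemma csum_stable (c : nat -> C) n N : (n <= N)%nat -> (forall k, (n <= k)%nat -> c k = 0) -> csum c N = csum c n.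
Proof.
  move=> h hc. elim: h => [|N' h IH] //=. rewrite IH hc //. ring.
Qed.

Lemma csum_sum_n (c : nat -> C) n : csum c (S n) = sum_n c n.
Proof.
  elim: n => [|n IH]; first by rewrite sum_O /=; ring.
  by rewrite sum_Sn -IH.
Qed.

Lemma csum_S c n : csum c (S n) = (csum c n + c n)%C.
Proof. by []. Qed.

Lemma csum_zero (c : nat -> C) n : (forall k, (k < n)%nat -> c k = 0) -> csum c n = 0.
Proof.
  elim: n => [|n IH] h //=. rewrite IH; last by move=> k hk; apply: h; lia. rewrite h; last lia. ring.
Qed.

(** Divide by x^n once the lower coefficients are known to vanish, and let x
    tend to 0. *)
Lemma asymptotic_unique (b : nat -> C) :
  (forall n, exists K, forall x, 0 < x <= 1 -> Cmod (csum (fun k => b k * RtoC x ^ k)%C n) <= K * x ^ n) ->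
  forall n, b n = 0.
Proof.
  move=> h n. elim/(well_founded_ind Wf_nat.lt_wf): n => n IH.
  case: (h (S n)) => K hK.
  have B : forall x, 0 < x <= 1 -> Cmod (b n) <= K * x.
  { move=> x hx. have := hK x hx. rewrite csum_S csum_zero; last by move=> k hk; rewrite IH //; ring.
    rewrite Cplus_0_l Cmod_mult Cmod_pow Cmod_R Rabs_pos_eq; last lra.
    have : 0 < x ^ n by apply: pow_lt; lra. move=> p q.
    apply (Rmult_le_reg_r (x ^ n)) => //. simpl in q. lra. }
  apply: NNPP => hb. have hp : 0 < Cmod (b n) by apply/Cmod_gt_0.
  have hK1 := B 1 ltac:(lra).
  have := B (Cmod (b n) / (2 * K)). move=> /(_ _).
  have -> : K * (Cmod (b n) / (2 * K)) = Cmod (b n) / 2 by field; lra.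
  have : 0 < Cmod (b n) / (2 * K) <= 1.
  { split; first by apply: Rdiv_lt_0_compat; lra.
    apply (Rmult_le_reg_r (2 * K)); first lra.
    replace (Cmod (b n) / (2 * K) * (2 * K)) with (Cmod (b n)) by (field; lra). lra. }
  move=> q /(_ q). lra.
Qed.

(** A full asymptotic expansion at 0 with coefficients a_i; nothing is said
    about convergence of the series. *)
Definition odd_expansion (f : R -> R) (a : nat -> R) : Prop :=
  forall m, exists K, 0 <= K /\ forall x, Rabs x <= 1 ->
    Rabs (f x - sum_f_R0 (fun i => a i * x ^ (2 * i + 1)) m) <= K * Rabs x ^ (2 * m + 2).

(** Averaging the Taylor polynomial over x and -x, and taking real parts, gives
    a second expansion of F on the real line, which by uniqueness is the first
    one: the A_k are real and vanish for even k. *)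
Lemma real_odd_expansion F : real_odd_entire F -> ~ polynomial_function F ->
  exists a, (forall x : R, F (RtoC x) = RtoC (fst (F (RtoC x)))) /\
    odd_expansion (fun x => fst (F (RtoC x))) a /\ forall d, exists k, (d <= k)%nat /\ a k <> 0.
Proof.
  move=> [hent hreal hodd] hnp.
  have hF : forall w, cdiff F w by move=> w; exact: cdiff_of_ex_derive.
  have hre : forall x : R, F (RtoC x) = RtoC (fst (F (RtoC x))).
  { by move=> x; case: (hreal x) => y ->. }
  have := taylor F hF. move: (taylor_coef F) => A hT.
  (* Re A_k for odd k and 0 for even k: the coefficients of x |-> Re (T(x) - T(-x)) / 2, T being the Taylor polynomial. *)
  set b := fun k => fst (A k) * ((1 - (-1) ^ k) / 2).
  case: (hT 2 ltac:(lra)) => M hM.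
  have M0 : 0 <= M.
  { have := hM 0%nat 0. rewrite Cmod_0 /= => /(_ ltac:(lra)). have := Cmod_ge_0 (F 0 - 0)%C. lra. }
  have approx : forall n x, Rabs x <= 1 ->
     Cmod (F (RtoC x) - csum (fun k => RtoC (b k) * RtoC x ^ k)%C n) <= M * Rabs x ^ n.
  { move=> n x hx.
    have p := hM n (RtoC x). have q := hM n (RtoC (- x)). rewrite !Cmod_R Rabs_Ropp in p q.
    have {}p := p ltac:(lra). have {}q := q ltac:(lra).
    set u := (F (RtoC x) - _)%C in p. set v := (F (RtoC (- x)) - _)%C in q.
    have -> : (F (RtoC x) - csum (fun k => RtoC (b k) * RtoC x ^ k)%C n)%C = RtoC ((fst u - fst v) / 2).
    { have -> : fst u = fst (F (RtoC x)) - fst (csum (fun k => A k * RtoC x ^ k)%C n) by [].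
      have -> : fst v = - fst (F (RtoC x)) - fst (csum (fun k => A k * RtoC (- x) ^ k)%C n).
      { rewrite /v RtoC_opp hodd //=. }
      rewrite hre. 
      have -> : csum (fun k => RtoC (b k) * RtoC x ^ k)%C n = 
         RtoC ((fst (csum (fun k => A k * RtoC x ^ k)%C n) - fst (csum (fun k => A k * RtoC (- x) ^ k)%C n)) / 2).
      { elim: n {p q u v} => [|n IH]; first by rewrite /=; apply: injective_projections => /=; field.
        simpl csum. rewrite IH -!RtoC_pow /b. replace (- x) with (-1 * x) by ring. rewrite Rpow_mult_distr.
        apply: injective_projections => /=; field. }
      rewrite -RtoC_minus. congr RtoC. simpl. field. }
    rewrite Cmod_R.
    have pu := fst_le_Cmod u. have pv := fst_le_Cmod v.
    have xn : 0 <= Rabs x ^ n by apply: pow_le; exact: Rabs_pos.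
    have : M * (Rabs x / 2) ^ n <= M * Rabs x ^ n.
    { apply: Rmult_le_compat_l => //. apply: pow_incr. have := Rabs_pos x; lra. }
    move=> hh. apply: Rabs_le.
    have /Rabs_le_between k1 : Rabs (fst u) <= M * Rabs x ^ n by lra.
    have /Rabs_le_between k2 : Rabs (fst v) <= M * Rabs x ^ n by lra.
    lra. }
  have eA : forall k, A k = RtoC (b k).
  { move=> k. have : (A k - RtoC (b k))%C = 0.
    { apply: (asymptotic_unique (fun k => A k - RtoC (b k))%C) => n. exists (2 * M) => x hx.
      rewrite (csum_ext _ (fun k => A k * RtoC x ^ k - RtoC (b k) * RtoC x ^ k)%C); last by move=> j; ring.
      rewrite csum_minus.
      have p := hM n (RtoC x). rewrite Cmod_R Rabs_pos_eq in p; last lra. have {}p := p ltac:(lra).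
      have q := approx n x. rewrite Rabs_pos_eq in q; last lra. have {}q := q ltac:(lra).
      set s := csum _ _ in p *. set t := csum _ _ in q *.
      replace (s - t)%C with ((F (RtoC x) - t) - (F (RtoC x) - s))%C by ring.
      apply: Rle_trans (Cmod_triangle _ _) _. rewrite Cmod_opp.
      have : M * (x / 2) ^ n <= M * x ^ n.
      { apply: Rmult_le_compat_l => //. apply: pow_incr. lra. }
      lra. }
    move=> e. replace (A k) with (A k - RtoC (b k) + RtoC (b k))%C by ring. rewrite e; ring. }
  have beven : forall i, b (2 * i)%nat = 0 by move=> i; rewrite /b pow_1_even; field.
  exists (fun i => b (2 * i + 1)%nat); split => //; split.
  - move=> m. exists M; split => // x hx.
    have h := approx (2 * m + 2)%nat x hx.
    have e : csum (fun k => RtoC (b k) * RtoC x ^ k)%C (2 * m + 2) =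
       RtoC (sum_f_R0 (fun i => b (2 * i + 1)%nat * x ^ (2 * i + 1)) m).
    { elim: m {h} => [|m IH].
      - have b0 := beven 0%nat. simpl in b0. rewrite /= b0. apply: injective_projections => /=; ring.
      - have -> : (2 * S m + 2 = S (S (2 * m + 2)))%nat by lia. rewrite [LHS]/= -/(Nat.mul 2 m) IH.
        have e2 : (m + (m + 0) + 2 = 2 * S m)%nat by lia. rewrite e2 beven.
        have -> : S (2 * S m) = (2 * S m + 1)%nat by lia.
        rewrite tech5 RtoC_plus RtoC_mult RtoC_pow.
        rewrite Nat.add_1_r Cpow_S. ring. }
    by rewrite e hre -RtoC_minus Cmod_R in h.
  - move=> d. apply: NNPP => hd. apply: hnp.
    have bz : forall k, (2 * d <= k)%nat -> b k = 0.
    { move=> k hk. case: (Nat.Even_or_Odd k) => [[i ->]|[i e]]; first exact: beven.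
      apply: NNPP => hb. apply: hd. exists i. split; first lia. by rewrite -e. }
    exists (2 * d)%nat, A => z. rewrite -csum_sum_n.
    set s := csum _ _.
    case: (hT (2 * Cmod z + 1) ltac:(have := Cmod_ge_0 z; lra)) => M' hM'.
    have : Cmod (F z - s) <= 0.
    { apply: le_epsilon => e he. rewrite Rplus_0_l.
      have z0 := Cmod_ge_0 z.
      set q := Cmod z / (2 * Cmod z + 1).
      have hq : 0 <= q <= / 2.
      { split; first by apply: Rdiv_le_0_compat; lra. apply (Rmult_le_reg_r (2 * Cmod z + 1)); first lra.
        rewrite /q. replace (Cmod z / (2 * Cmod z + 1) * (2 * Cmod z + 1)) with (Cmod z) by (field; lra). lra. }
      case: (pow2_unbounded (Rabs M' / e)) => n hn.
      have := hM' (S (2 * d) + n)%nat z ltac:(lra). rewrite (csum_stable _ (S (2 * d))); first last.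
      { move=> k hk. rewrite eA bz; last lia. ring. }
      { lia. }
      rewrite -/s -/q => h. apply: Rle_trans h _.
      have p2 : 0 < 2 ^ n by apply: pow_lt; lra.
      have q1 : q ^ (S (2 * d) + n) <= / 2 ^ n.
      { rewrite pow_add -pow_inv. have : q ^ n <= (/ 2) ^ n by apply: pow_incr; lra.
        have : q ^ S (2 * d) <= 1 by rewrite -(pow1 (S (2 * d))); apply: pow_incr; lra.
        have : 0 <= q ^ S (2 * d) by apply: pow_le; lra.
        have : 0 <= q ^ n by apply: pow_le; lra. nra. }
      have q0 : 0 <= q ^ (S (2 * d) + n) by apply: pow_le; lra.
      apply: Rle_trans (_ : Rabs M' * / 2 ^ n <= e).
      - have := Rle_abs M'. have := Rabs_pos M'. nra.
      - apply (Rmult_le_reg_r (2 ^ n)) => //. rewrite Rmult_assoc Rinv_l; last lra.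
        apply (Rmult_lt_compat_r e) in hn => //. replace (Rabs M' / e * e) with (Rabs M') in hn by (field; lra).
        lra. }
    have := Cmod_ge_0 (F z - s)%C => h1 h2. have : Cmod (F z - s)%C = 0 by lra.
    move/Cmod_eq_0 => e. replace (F z) with (F z - s + s)%C by ring. rewrite e; ring.
Qed.

(** * Abundance of terms of the sequence near a small point *)

Lemma ln_le_sub1 t : 0 < t -> ln t <= t - 1.
Proof.
  move=> ht. have := exp_ineq1_le (ln t). rewrite exp_ln //. lra.
Qed.

(** Let a = 1 / |p|.  The indices J, J + 2, J + 4, ... of the right parity just
    above e^a have 1 / ln(j + 2) within about (j + 2 - e^a) e^(-a) of |p|.  Among
    the first K + 1 of them one is not in a list of K used indices. *)
Lemma xseq_near p N used : 0 < Rabs p <= 1 -> INR N + 2 <= exp (/ Rabs p) ->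
  exists j, (N <= j)%nat /\ ~ In j used /\
    Rabs (xseq j - p) <= (2 * INR (length used) + 2) * exp (- / Rabs p).
Proof.
  move=> hp hN. set a := / Rabs p in hN *. set X := exp a in hN *.
  have ha : 1 <= a by rewrite -Rinv_1 /a; apply: Rinv_le_contravar; lra.
  have hX : 2 <= X by have := exp_ineq1_le a; rewrite -/X; lra.
  case: (nfloor_ex X) => [|n [hn1 hn2]]; first lra.
  have n2 : (2 <= n)%nat.
  { have : INR 1 < INR n by rewrite /=; lra. move/INR_lt. lia. }
  (* J has the parity dictated by the sign of p *)
  have : exists J, X <= INR J + 2 <= X + 2 /\ (N <= J)%nat /\ (-1) ^ J * Rabs p = p.
  { have nn : exists J0, n = S J0 by exists (pred n); lia.
    case: nn => J0 e. have eI : INR n = INR J0 + 1 by rewrite e S_INR.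
    have hNJ : (N <= J0)%nat.
    { apply/Nat.lt_succ_r. apply: INR_lt. rewrite S_INR. lra. }
    have par : forall s, s = 1 \/ s = -1 -> exists J, (J = J0 \/ J = S J0) /\ (-1) ^ J = s.
    { have h1 : (-1) ^ J0 = 1 \/ (-1) ^ J0 = -1.
      { elim: (J0) => [|m [IH|IH]] /=; [left | right | left]; try rewrite IH; lra. }
      move=> s hs. case: (Req_dec ((-1) ^ J0) s) => h; first by exists J0; split; [left|].
      exists (S J0); split; first by right. simpl. lra. }
    case: (Rle_dec 0 p) => h.
    - case: (par 1 ltac:(lra)) => J [hJ eJ]. exists J. rewrite eJ Rabs_pos_eq //.
      case: hJ => ->; rewrite ?S_INR; (split; [lra | split; [lia | lra]]).
    - case: (par (-1) ltac:(lra)) => J [hJ eJ]. exists J. rewrite eJ Rabs_left; last lra.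
      case: hJ => ->; rewrite ?S_INR; (split; [lra | split; [lia | lra]]). }
  move=> [J [[hJ1 hJ2] [hNJ sJ]]].
  set K := length used.
  have good : forall i, (i <= K)%nat ->
     Rabs (xseq (J + 2 * i) - p) <= (2 * INR K + 2) * exp (- a).
  { move=> i hi. have hiK : INR i <= INR K by exact: le_INR.
    have i0 := pos_INR i.
    set b := ln (INR (J + 2 * i) + 2).
    have eb : INR (J + 2 * i) + 2 = INR J + 2 + 2 * INR i by rewrite plus_INR mult_INR /=; ring.
    have hb1 : a <= b.
    { rewrite -(ln_exp a) /b. apply: ln_le; [exact: exp_pos | rewrite -/X; lra]. }
    have hb2 : b - a <= (2 * INR K + 2) * exp (- a).
    { have -> : b - a = ln ((INR (J + 2 * i) + 2) / X).
      { rewrite ln_div; [|lra|lra]. by rewrite /X ln_exp. }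
      apply: Rle_trans (ln_le_sub1 _ _) _; first by apply: Rdiv_lt_0_compat; lra.
      rewrite exp_Ropp -/X. apply (Rmult_le_reg_r X); first lra.
      replace (((INR (J + 2 * i) + 2) / X - 1) * X) with (INR (J + 2 * i) + 2 - X) by (field; lra).
      replace ((2 * INR K + 2) * / X * X) with (2 * INR K + 2) by (field; lra). lra. }
    have -> : xseq (J + 2 * i) - p = (-1) ^ J * (/ b - / a).
    { rewrite /xseq -/b pow_add pow_1_even -{1}sJ /a Rinv_inv. field. lra. }
    rewrite Rabs_mult pow_1_abs Rmult_1_l.
    have -> : / b - / a = - ((b - a) / (a * b)) by field; lra.
    rewrite Rabs_Ropp Rabs_pos_eq; last by apply: Rdiv_le_0_compat; nra.
    apply: Rle_trans _ hb2. apply (Rmult_le_reg_r (a * b)); first nra.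
    replace ((b - a) / (a * b) * (a * b)) with (b - a) by (field; lra).
    have : 1 <= a * b by nra. nra. }
  have [i [hi hni]] : exists i, (i <= K)%nat /\ ~ In (J + 2 * i)%nat used.
  { apply: NNPP => hno.
    have inc : incl (map (fun i => (J + 2 * i)%nat) (seq 0 (S K))) used.
    { move=> j /in_map_iff [i [<- /in_seq hi]]. apply: NNPP => h. apply: hno. exists i; split => //. lia. }
    have nd : NoDup (map (fun i => (J + 2 * i)%nat) (seq 0 (S K))).
    { apply: FinFun.Injective_map_NoDup; last exact: seq_NoDup. move=> u v h. lia. }
    have := NoDup_incl_length nd inc. rewrite length_map length_seq -/K. lia. }
  exists (J + 2 * i)%nat; split; first lia. split => //. exact: good.
Qed.

(** Greedy choice: each new index avoids the earlier ones, at most M in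
    number. *)
Lemma terms_near_points (rho : R) (N M : nat) (P : list R) : 0 < rho <= 1 -> INR N + 2 <= exp (/ rho) ->
  (length P <= M)%nat -> (forall p, In p P -> 0 < Rabs p <= rho) ->
  exists L, NoDup L /\ (forall j, In j L -> (N <= j)%nat) /\
    Forall2 (fun x p => Rabs (x - p) <= (2 * INR M + 2) * exp (- / rho)) (map xseq L) P.
Proof.
  move=> hr hN. elim: P => [|p P IH] hM hP.
  { exists []; split; [exact: NoDup_nil | split => //; exact: Forall2_nil]. }
  case: IH => [|q hq|L [nd [hL f2]]]; [by simpl in hM; lia | by apply: hP; right |].
  have hp := hP p (or_introl (eq_refl)).
  have inv : / rho <= / Rabs p by apply: Rinv_le_contravar; lra.
  have expm : forall u v, u <= v -> exp u <= exp v.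
  { move=> u v [h|->]; [apply: Rlt_le; exact: exp_increasing | lra]. }
  have e1 := expm _ _ inv.
  case: (xseq_near p N L) => [||j [hj [nj bj]]]; [lra | lra |].
  exists (j :: L); split; first exact: NoDup_cons. split.
  { move=> i [<-|hi] //. exact: hL. }
  simpl. constructor => //. apply: Rle_trans bj _.
  have lenL : length L = length P by rewrite -(length_map xseq); exact: Forall2_length f2.
  apply: Rmult_le_compat; [have := pos_INR (length L); lra | apply: Rlt_le; exact: exp_pos | | apply: expm; lra].
  have : INR (length L) <= INR M by apply: le_INR; rewrite lenL; simpl in hM; lia. lra.
Qed.

Lemma xseq_le1 j : (1 <= j)%nat -> Rabs (xseq j) <= 1.
Proof.
  move=> hj. have h1 : INR 1 <= INR j by exact: le_INR. simpl in h1.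
  have hl : 1 <= ln (INR j + 2).
  { rewrite -(ln_exp 1). apply: ln_le; first exact: exp_pos. have := exp_le_3. lra. }
  rewrite /xseq /Rdiv Rabs_mult Rabs_inv pow_1_abs (Rabs_pos_eq (ln _)); last lra.
  rewrite Rmult_1_l -Rinv_1. apply: Rinv_le_contravar; lra.
Qed.

Lemma xseq_cv e : 0 < e -> exists n0, forall n, (n0 <= n)%nat -> Rabs (xseq n) <= e.
Proof.
  move=> he. case: (nfloor_ex (exp (/ e))) => [|n0 [h1 h2]]; first by apply: Rlt_le; exact: exp_pos.
  exists n0 => n hn. have hn' : INR n0 <= INR n by exact: le_INR.
  have ie : 0 < / e by exact: Rinv_0_lt_compat.
  have hl : / e <= ln (INR n + 2).
  { rewrite -(ln_exp (/ e)). apply: ln_le; first exact: exp_pos. lra. }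
  rewrite /xseq /Rdiv Rabs_mult Rabs_inv pow_1_abs (Rabs_pos_eq (ln _)); last lra.
  rewrite Rmult_1_l -[X in _ <= X]Rinv_inv. exact: Rinv_le_contravar.
Qed.

(** * Gadgets: finite point sets isolating one odd power sum *)

Definition sum_at (f : R -> R) (P : list R) : R := fold_right (fun p s => f p + s) 0 P.

Lemma sum_at_app f P Q : sum_at f (P ++ Q) = sum_at f P + sum_at f Q.
Proof. elim: P => [|p P IH] /=; [rewrite /sum_at /=; ring | rewrite IH; ring]. Qed.

Lemma sum_at_bound f c P : (forall p, In p P -> Rabs (f p) <= c) -> Rabs (sum_at f P) <= INR (length P) * c.
Proof.
  elim: P => [|p P IH] h; first by rewrite /= Rabs_R0; lra.
  rewrite [length _]/= S_INR /=. have := h p (or_introl eq_refl). 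
  have := IH (fun q hq => h q (or_intror hq)). have := Rabs_triang (f p) (sum_at f P). lra.
Qed.

Lemma sum_at_scal c f P : sum_at (fun x => c * f x) P = c * sum_at f P.
Proof. elim: P => [|p P IH] /=; [ring | rewrite IH; ring]. Qed.

Lemma sum_at_plus f g P : sum_at (fun x => f x + g x) P = sum_at f P + sum_at g P.
Proof. elim: P => [|p P IH] /=; [ring | rewrite IH; ring]. Qed.

Lemma sum_at_abs f g P : (forall p, In p P -> Rabs (f p) <= g p) -> Rabs (sum_at f P) <= sum_at g P.
Proof.
  elim: P => [|p P IH] h /=; first by rewrite Rabs_R0; lra. have := h p (or_introl eq_refl).
  have := IH (fun q hq => h q (or_intror hq)). have := Rabs_triang (f p) (sum_at f P). lra.
Qed.

Lemma sum_at_firstn_mono f P q : (forall p, 0 <= f p) -> sum_at f (firstn q P) <= sum_at f P.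
Proof.
  move=> h. have pos : forall Q, 0 <= sum_at f Q.
  { elim=> [|p Q IH] /=; first lra. have := h p; lra. }
  rewrite -{2}(firstn_skipn q P) sum_at_app. have := pos (skipn q P). lra.
Qed.

Lemma sum_at_Forall2 f c X P : 0 <= c -> Forall2 (fun x p => Rabs (f x - f p) <= c) X P ->
  forall q, Rabs (sum_at f (firstn q X) - sum_at f (firstn q P)) <= INR (length P) * c.
Proof.
  move=> hc. elim=> [|x p X' P' hxp h2 IH] q.
  { rewrite !firstn_nil /= Rminus_diag Rabs_R0; lra. }
  have l0 := pos_INR (length P'). rewrite [length _]/= S_INR.
  case: q => [|q]; first by rewrite /= Rminus_diag Rabs_R0; nra.
  rewrite !firstn_cons /=. have := IH q.
  have := Rabs_triang (f x - f p) (sum_at f (firstn q X') - sum_at f (firstn q P')).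
  replace (f x - f p + (sum_at f (firstn q X') - sum_at f (firstn q P'))) with
    (f x + sum_at f (firstn q X') - (f p + sum_at f (firstn q P'))) by ring. lra.
Qed.

Definition block (T : nat) (G : list R) : list R := concat (repeat G T).

Lemma sum_at_block f T G : sum_at f (block T G) = INR T * sum_at f G.
Proof.
  elim: T => [|T IH]; first by rewrite /=; ring.
  rewrite S_INR /block /= sum_at_app. move: IH; rewrite /block => ->. ring.
Qed.

Lemma length_block T G : length (block T G) = (T * length G)%nat.
Proof. elim: T => [|T IH] //. rewrite /block /= length_app. move: IH; rewrite /block => ->. lia. Qed.

Lemma In_block p T G : In p (block T G) -> In p G.
Proof. elim: T => [|T IH] //. rewrite /block /= => /in_app_iff [] //. Qed.

Lemma firstn_block q T G : exists t q', (t <= T)%nat /\ firstn q (block T G) = block t G ++ firstn q' G.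
Proof.
  elim: T q => [|T IH] q.
  { exists 0%nat, 0%nat; split => //. by rewrite /block /= firstn_nil. }
  rewrite /block /= firstn_app -/(block T G).
  case: (Nat.le_gt_cases q (length G)) => h.
  - exists 0%nat, q; split; first lia. replace (q - length G)%nat with 0%nat by lia.
    by rewrite firstn_O app_nil_r.
  - case: (IH (q - length G)%nat) => t [q' [ht e]]. exists (S t), q'; split; first lia.
    rewrite e firstn_all2; last lia. by rewrite /block /= app_assoc.
Qed.

(** A point set with multiplicities on which the odd power sums of order
    i < k vanish.  If L is the functional f |-> sum of f over gadget k y, then
    gadget (k+1) y realises f |-> L(f)(2 y) - 2^(2k+1) L(f)(y), which annihilates
    the power of order k and rescales the others; the minus sign is produced by
    opposite points, as the functions are odd. *)
Fixpoint gadget (k : nat) (y : R) : list R :=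
  match k with
  | O => [y]
  | S k' => gadget k' (2 * y) ++ block (2 ^ (2 * k' + 1)) (map Ropp (gadget k' y))
  end.

Fixpoint gadget_coef (k i : nat) : R :=
  match k with O => 1 | S k' => gadget_coef k' i * (2 ^ (2 * i + 1) - 2 ^ (2 * k' + 1)) end.

Definition odd_pow (i : nat) (x : R) : R := x ^ (2 * i + 1).

Lemma odd_pow_opp i x : odd_pow i (- x) = - odd_pow i x.
Proof.
  rewrite /odd_pow. replace (- x) with (-1 * x) by ring. rewrite Rpow_mult_distr Nat.add_1_r pow_1_odd. ring.
Qed.

Lemma sum_at_odd_pow_opp i P : sum_at (odd_pow i) (map Ropp P) = - sum_at (odd_pow i) P.
Proof. elim: P => [|p P IH] /=; [ring | rewrite IH odd_pow_opp; ring]. Qed.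

Lemma sum_at_gadget k i y : sum_at (odd_pow i) (gadget k y) = gadget_coef k i * odd_pow i y.
Proof.
  elim: k y => [|k IH] y; first by rewrite /=; ring.
  cbn [gadget gadget_coef]. rewrite sum_at_app sum_at_block sum_at_odd_pow_opp !IH pow_INR {1}/odd_pow Rpow_mult_distr -/(odd_pow i y).
  rewrite (_ : INR 2 = 2) //. ring.
Qed.

Lemma gadget_coef_lt k i : (i < k)%nat -> gadget_coef k i = 0.
Proof.
  elim: k => [|k IH] h; first lia. cbn [gadget_coef].
  case: (Nat.eq_dec i k) => [->|n]; first ring. rewrite IH; [ring | lia].
Qed.

Lemma gadget_coef_ge k i : (k <= i)%nat -> gadget_coef k i <> 0.
Proof.
  elim: k => [|k IH] h; first by rewrite /=; lra. cbn [gadget_coef].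
  apply: Rmult_integral_contrapositive_currified; first by apply: IH; lia.
  have := Rlt_pow 2 (2 * k + 1) (2 * i + 1) ltac:(lra) ltac:(lia). lra.
Qed.

Lemma length_gadget k y y' : length (gadget k y) = length (gadget k y').
Proof.
  elim: k y y' => [|k IH] y y' //. cbn [gadget].
  rewrite !length_app !length_block !length_map (IH (2 * y) (2 * y')) (IH y y') //.
Qed.

Lemma In_gadget k y p : y <> 0 -> In p (gadget k y) -> 0 < Rabs p <= 2 ^ k * Rabs y.
Proof.
  elim: k y p => [|k IH] y p hy; cbn [gadget].
  { move=> [<-|] // /=. have := Rabs_pos_lt _ hy. lra. }
  have e : 2 ^ S k * Rabs y = 2 * (2 ^ k * Rabs y) by simpl; ring.
  have k0 : 0 <= 2 ^ k * Rabs y by apply: Rmult_le_pos; [apply: pow_le; lra | exact: Rabs_pos].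
  rewrite e => /in_app_iff [h|/In_block/in_map_iff [p' [<- h]]].
  - have := IH (2 * y) p ltac:(lra) h. rewrite Rabs_mult (Rabs_pos_eq 2); lra.
  - have := IH y p' hy h. rewrite Rabs_Ropp. lra.
Qed.

Lemma pow_le1 x n : 0 <= x <= 1 -> x ^ (S n) <= x.
Proof.
  move=> hx. simpl. have : x ^ n <= 1 by rewrite -(pow1 n); apply: pow_incr.
  have : 0 <= x ^ n by apply: pow_le; lra. nra.
Qed.

Lemma odd_pow_le1 i x c : Rabs x <= c -> c <= 1 -> Rabs (odd_pow i x) <= c.
Proof.
  move=> h1 h2. rewrite /odd_pow -RPow_abs Nat.add_1_r. have := Rabs_pos x => h0.
  apply: Rle_trans (pow_le1 _ _ _) _; lra.
Qed.

(** Points, not yet terms of the sequence, that move the k-th odd power sum by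
    r.  About |r| / (|lambda| h^(2k+1)) copies of a gadget of scale h are used,
    lambda being the k-th coefficient of the gadget.  Lower sums are disturbed
    only by an incomplete copy, higher ones are O(h) because |p| = O(h) for all
    points; the scale h is left free because it has to be adapted to
    the sequence later. *)
Lemma ideal_move k r : exists D, 0 <= D /\ forall h, 0 < h -> 2 ^ k * h <= 1 -> exists P : list R,
  (forall p, In p P -> 0 < Rabs p <= 2 ^ k * h) /\
  INR (length P) * h ^ (2 * k + 1) <= D /\
  (forall q i, (i < k)%nat -> Rabs (sum_at (odd_pow i) (firstn q P)) <= D * h) /\
  (forall q, Rabs (sum_at (odd_pow k) (firstn q P)) <= Rabs r + D * h) /\
  Rabs (sum_at (odd_pow k) P - r) <= D * h /\
  sum_at (fun x => Rabs x ^ (2 * k + 2)) P <= D * h.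
Proof.
  set g := INR (length (gadget k 0)).
  have g0 : 0 <= g by exact: pos_INR.
  have hln := gadget_coef_ge k k (le_n _).
  set la := Rabs (gadget_coef k k). have la0 : 0 < la by exact: Rabs_pos_lt.
  have r0 := Rabs_pos r.
  have k1 : 1 <= 2 ^ k by apply: pow_R1_Rle; lra.
  set c1 := g * 2 ^ k. set c2 := g * (Rabs r / la). set c3 := c2 * (2 ^ k) ^ (2 * k + 2).
  have rl : 0 <= Rabs r / la by exact: Rdiv_le_0_compat.
  have hc1 : 0 <= c1 by rewrite /c1; nra.
  have hc2 : 0 <= c2 by rewrite /c2; nra.
  have hc3 : 0 <= c3 by apply: Rmult_le_pos => //; apply: pow_le; lra.
  exists (la + c1 + c2 + c3); split; first lra.
  move=> h hh h2. set D := la + c1 + c2 + c3.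
  have h1 : h <= 1 by nra.
  have dh : forall c, c <= D -> c * h <= D * h by move=> c hc; apply: Rmult_le_compat_r; lra.
  have [s [s1 s2]] : exists s, (s = 1 \/ s = -1) /\ gadget_coef k k * s * Rabs r = la * r.
  { rewrite /la. case: (Rle_dec 0 (gadget_coef k k * r)) => hs.
    - exists 1; split; first by left. rewrite Rmult_1_r.
      case: (Rle_dec 0 r) => hr; first (case: (Req_dec r 0) => [->|hr0]; first by rewrite Rabs_R0; ring).
      + have rp : 0 < r by lra. have lp : 0 <= gadget_coef k k by nra. by rewrite (Rabs_pos_eq r) // (Rabs_pos_eq (gadget_coef k k)).
      + have lm : gadget_coef k k < 0 by nra.
        rewrite (Rabs_left r); last lra. rewrite (Rabs_left (gadget_coef k k)); [ring|lra].
    - exists (-1); split; first by right.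
      case: (Rle_dec 0 r) => hr.
      + rewrite (Rabs_pos_eq r) // (Rabs_left (gadget_coef k k)); [ring|nra].
      + rewrite (Rabs_left r); last lra. rewrite (Rabs_pos_eq (gadget_coef k k)); [ring|nra]. }
  (* The sign s of y makes the copies move the sum in the direction of r. *)
  set y := s * h.
  have ay : Rabs y = h.
  { rewrite /y Rabs_mult (Rabs_pos_eq h); last lra. case: s1 => ->; rewrite ?Rabs_Ropp Rabs_R1; ring. }
  have y0 : y <> 0 by move=> e; rewrite e Rabs_R0 in ay; lra.
  set G := gadget k y.
  have lG : INR (length G) = g by rewrite /G (length_gadget k y 0).
  set hk := h ^ (2 * k + 1). have hk0 : 0 < hk by exact: pow_lt.
  have hkh : hk <= h by rewrite /hk Nat.add_1_r; apply: pow_le1; lra.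
  set c := la * hk. have c0 : 0 < c by rewrite /c; nra.
  case: (nfloor_ex (Rabs r / c)) => [|T [hT1 hT2]]; first exact: Rdiv_le_0_compat.
  have hTc : INR T * c <= Rabs r.
  { apply (Rmult_le_compat_r c) in hT1; last lra. replace (Rabs r / c * c) with (Rabs r) in hT1 by (field; lra). lra. }
  have hTc2 : Rabs r < INR T * c + c.
  { apply (Rmult_lt_compat_r c) in hT2; last lra. replace (Rabs r / c * c) with (Rabs r) in hT2 by (field; lra). lra. }
  have oy : odd_pow k y = s * hk.
  { rewrite /odd_pow /y Rpow_mult_distr -/hk. congr (_ * _). case: s1 => ->; first exact: pow1.
    by rewrite Nat.add_1_r pow_1_odd. }
  have inG : forall p, In p G -> 0 < Rabs p <= 2 ^ k * h.
  { move=> p hp. rewrite -ay. exact: In_gadget hp. }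
  have part : forall q' i, Rabs (sum_at (odd_pow i) (firstn q' G)) <= c1 * h.
  { move=> q' i. apply: Rle_trans (sum_at_bound _ (2 ^ k * h) _ _) _.
    - move=> p hp. have hp' : In p G by rewrite -(firstn_skipn q' G); apply/in_app_iff; left.
      apply: odd_pow_le1 => //. exact: (proj2 (inG p hp')).
    - rewrite /c1 Rmult_assoc. apply: Rmult_le_compat_r; first nra.
      rewrite -lG. apply: le_INR. rewrite length_firstn. lia. }
  exists (block T G); split; [|split; [|split; [|split; [|split]]]].
  - move=> p hp. apply: inG. exact: In_block hp.
  - rewrite length_block mult_INR lG. apply: Rle_trans (_ : c2 <= D); last by rewrite /D; lra.
    rewrite /c2. have -> : INR T * g * hk = g * (INR T * c / la) by rewrite /c; field; lra.
    apply: Rmult_le_compat_l => //. apply: Rmult_le_compat_r => //. apply: Rlt_le; exact: Rinv_0_lt_compat.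
  - move=> q i hi. case: (firstn_block q T G) => t [q' [ht ->]].
    rewrite sum_at_app sum_at_block sum_at_gadget gadget_coef_lt // Rmult_0_l Rmult_0_r Rplus_0_l.
    apply: Rle_trans (part _ _) _. apply: dh. rewrite /D; lra.
  - move=> q. case: (firstn_block q T G) => t [q' [ht ->]].
    rewrite sum_at_app sum_at_block sum_at_gadget oy. apply: Rle_trans (Rabs_triang _ _) _.
    have ht' : INR t <= INR T by exact: le_INR. have t0 := pos_INR t.
    have : Rabs (INR t * (gadget_coef k k * (s * hk))) <= Rabs r.
    { rewrite !Rabs_mult -/la (Rabs_pos_eq _ t0) (Rabs_pos_eq hk); last lra.
      have -> : Rabs s = 1 by case: s1 => ->; rewrite ?Rabs_Ropp Rabs_R1.
      have : INR t * c <= INR T * c by apply: Rmult_le_compat_r; lra. rewrite /c in hTc *. lra. }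
    have := part q' k. have := dh c1 ltac:(rewrite /D; lra). lra.
  - rewrite sum_at_block sum_at_gadget oy.
    have e : la * (INR T * (gadget_coef k k * (s * hk)) - r) = gadget_coef k k * s * (INR T * c - Rabs r).
    { rewrite Rmult_minus_distr_l -s2 /c. ring. }
    have e2 : la * Rabs (INR T * (gadget_coef k k * (s * hk)) - r) = la * Rabs (INR T * c - Rabs r).
    { rewrite -{1}(Rabs_pos_eq la); last lra. rewrite -Rabs_mult e !Rabs_mult -/la.
      have -> : Rabs s = 1 by case: s1 => ->; rewrite ?Rabs_Ropp Rabs_R1. ring. }
    apply Rmult_eq_reg_l in e2; last lra. rewrite e2.
    apply: Rle_trans (_ : c <= _); first by apply: Rabs_le; lra.
    apply: Rle_trans (_ : la * h <= _); first by apply: Rmult_le_compat_l; lra.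
    apply: dh. rewrite /D; lra.
  - apply: Rle_trans (Rle_abs _) _. apply: Rle_trans (sum_at_bound _ ((2 ^ k * h) ^ (2 * k + 2)) _ _) _.
    + move=> p hp. have hp' := inG p (In_block _ _ _ hp). rewrite Rabs_pos_eq; last by apply: pow_le; lra.
      apply: pow_incr; lra.
    + rewrite length_block mult_INR lG Rpow_mult_distr.
      have -> : h ^ (2 * k + 2) = hk * h by rewrite /hk (_ : (2 * k + 2 = S (2 * k + 1))%nat); [simpl; ring | lia].
      apply: Rle_trans (_ : c3 * h <= _); last by apply: dh; rewrite /D; lra.
      have -> : INR T * g * ((2 ^ k) ^ (2 * k + 2) * (hk * h)) =
        (g * (INR T * c / la)) * (2 ^ k) ^ (2 * k + 2) * h by rewrite /c; field; lra.
      apply: Rmult_le_compat_r; first lra. apply: Rmult_le_compat_r; first by apply: pow_le; lra.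
      apply: Rmult_le_compat_l => //. apply: Rmult_le_compat_r => //. apply: Rlt_le; exact: Rinv_0_lt_compat.
Qed.

(** * Moving finitely many sums with blocks of fresh terms *)

Lemma exp_mult_nat n x : exp (INR n * x) = exp x ^ n.
Proof.
  elim: n => [|n IH]; first by rewrite Rmult_0_l exp_0.
  rewrite S_INR Rmult_plus_distr_r Rmult_1_l exp_plus IH /=. ring.
Qed.

(** Exponential smallness beats each power: with m = n + 1,
    e^(-1/rho) = (e^(-1/(m rho)))^m and e^u >= u. *)
Lemma exp_neg_inv rho n : 0 < rho -> exp (- / rho) <= (INR (S n) * rho) ^ (S n).
Proof.
  move=> hr. set m := INR (S n). have hm : 0 < m by apply: lt_0_INR; lia.
  have hmr : 0 < m * rho by nra.
  have e : exp (- / rho) = (exp (- / (m * rho))) ^ S n.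
  { rewrite -exp_mult_nat. congr exp. rewrite -/m. field. lra. }
  rewrite e. apply: pow_incr; split; first by apply: Rlt_le; exact: exp_pos.
  rewrite exp_Ropp -{2}(Rinv_inv (m * rho)). apply: Rinv_le_contravar; first exact: Rinv_0_lt_compat.
  have := exp_ineq1_le (/ (m * rho)). lra.
Qed.

Lemma pow_lip n a b : Rabs a <= 1 -> Rabs b <= 1 -> Rabs (a ^ n - b ^ n) <= INR n * Rabs (a - b).
Proof.
  move=> ha hb. elim: n => [|n IH]; first by rewrite /= Rminus_diag Rabs_R0; have := Rabs_pos (a-b); lra.
  rewrite S_INR. have -> : a ^ S n - b ^ S n = a * (a ^ n - b ^ n) + (a - b) * b ^ n by simpl; ring.
  apply: Rle_trans (Rabs_triang _ _) _. rewrite !Rabs_mult.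
  have : Rabs (b ^ n) <= 1.
  { rewrite -RPow_abs -(pow1 n). apply: pow_incr. have := Rabs_pos b; lra. }
  have := Rabs_pos (a - b). have := Rabs_pos (a ^ n - b ^ n). have := Rabs_pos (b ^ n). have := Rabs_pos a. nra.
Qed.

(** Choosing N beyond all indices spent so far allows blocks chosen one after the
    other to be concatenated without repeating an index. *)
Definition fresh (N : nat) (L : list nat) : Prop := NoDup L /\ forall j, In j L -> (N <= j)%nat.

(** Replace the points of [ideal_move] by nearby terms.  The number of points
    is at most D / h^(2k+1), the distance to the terms is exponentially small in
    1/h, and so the accumulated error is O(h).  The bound on the sum of
    |x|^(2k+2) is what controls the remainder of an expansion of order k. *)
Lemma move_power_sum k r e N : 0 < e -> exists L, fresh (S N) L /\
  (forall q i, (i < k)%nat -> Rabs (sum_at (odd_pow i) (firstn q (map xseq L))) <= e) /\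
  (forall q, Rabs (sum_at (odd_pow k) (firstn q (map xseq L))) <= Rabs r + e) /\
  Rabs (sum_at (odd_pow k) (map xseq L) - r) <= e /\
  sum_at (fun x => Rabs x ^ (2 * k + 2)) (map xseq L) <= e.
Proof.
  move=> he. case: (ideal_move k r) => D [D0 hD].
  set d := INR (2 * k + 2). have d0 : 0 < d by apply: lt_0_INR; lia.
  (* The squared number of points is O(h^(-(4k+2))); the power n + 1 = 4k + 3 leaves one factor h. *)
  set n := (4 * k + 2)%nat.
  set E := 2 * (D + 1) ^ 2 * d * (INR (S n) * 2 ^ k) ^ S n.
  have k1 : 1 <= 2 ^ k by apply: pow_R1_Rle; lra.
  have E0 : 0 <= E.
  { rewrite /E. apply: Rmult_le_pos; first by apply: Rmult_le_pos; nra.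
    apply: pow_le. apply: Rmult_le_pos; [exact: pos_INR | lra]. }
  have N0 := pos_INR N. have N1 : INR (S N) = INR N + 1 by rewrite S_INR.
  set h := / (2 ^ k * (INR N + 3) + 2 * D / e + 2 * E / e).
  have q1 : 0 <= 2 * D / e by apply: Rdiv_le_0_compat; lra.
  have q2 : 0 <= 2 * E / e by apply: Rdiv_le_0_compat; lra.
  have den : 2 ^ k * (INR N + 3) <= 2 ^ k * (INR N + 3) + 2 * D / e + 2 * E / e by lra.
  have den0 : 0 < 2 ^ k * (INR N + 3) by nra.
  have h0 : 0 < h by apply: Rinv_0_lt_compat; lra.
  have hinv : h * (2 ^ k * (INR N + 3) + 2 * D / e + 2 * E / e) = 1 by rewrite /h; field; split; nra.
  have hD2 : D * h <= e / 2.
  { have : h * (2 * D / e) <= 1 by nra. move=> hh. apply (Rmult_le_reg_r (2 / e)); first by apply: Rdiv_lt_0_compat; lra.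
    replace (e / 2 * (2 / e)) with 1 by (field; lra). apply: Rle_trans _ hh. apply: Req_le. field. lra. }
  have hE2 : E * h <= e / 2.
  { have : h * (2 * E / e) <= 1 by nra. move=> hh. apply (Rmult_le_reg_r (2 / e)); first by apply: Rdiv_lt_0_compat; lra.
    replace (e / 2 * (2 / e)) with 1 by (field; lra). apply: Rle_trans _ hh. apply: Req_le. field. lra. }
  have hN : h * (2 ^ k * (INR N + 3)) <= 1 by nra.
  set rho := 2 ^ k * h.
  have rho0 : 0 < rho by rewrite /rho; nra.
  have rho1 : rho <= 1 by rewrite /rho; nra.
  have rhoN : INR (S N) + 2 <= exp (/ rho).
  { apply: Rle_trans (_ : / rho <= _); last by have := exp_ineq1_le (/ rho); lra.
    rewrite N1. apply (Rmult_le_reg_r rho) => //. rewrite Rinv_l; last lra. rewrite /rho. lra. }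
  case: (hD h h0 rho1) => P [inP [lenP [P1 [P2 [P3 P4]]]]].
  set M := length P in lenP.
  case: (terms_near_points rho (S N) M P (conj rho0 rho1) rhoN (le_n _) inP) => L [nd [hL F2]].
  set eta := (2 * INR M + 2) * exp (- / rho) in F2.
  have M0 := pos_INR M.
  have h1 : h <= 1 by nra.
  have eta0 : 0 <= eta by apply: Rmult_le_pos; [lra | apply: Rlt_le; exact: exp_pos].
  (* d is a common Lipschitz constant on [-1, 1] of the powers involved, so this is the total error. *)
  have tot : INR M * (d * eta) <= e / 2.
  { apply: Rle_trans _ hE2.
    set hk := h ^ (2 * k + 1) in lenP. have hk0 : 0 < hk by exact: pow_lt.
    have hk1 : hk <= 1 by rewrite /hk -(pow1 (2*k+1)); apply: pow_incr; lra.
    have l2 : (INR M + 1) * hk <= D + 1 by lra.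
    have l3 : ((INR M + 1) * hk) ^ 2 <= (D + 1) ^ 2 by apply: pow_incr; split => //; nra.
    have ex := exp_neg_inv rho n rho0.
    have hn : h ^ S n = hk ^ 2 * h by rewrite /hk -pow_mult /n -tech_pow_Rmult (_ : ((2 * k + 1) * 2 = 4 * k + 2)%nat); [ring | lia].
    have exq : exp (- / rho) <= (INR (S n) * 2 ^ k) ^ S n * (hk ^ 2 * h).
    { rewrite -hn -Rpow_mult_distr. move: ex. rewrite /rho Rmult_assoc //. }
    set Z := (INR (S n) * 2 ^ k) ^ S n in exq.
    have Z0 : 0 <= Z by apply: pow_le; apply: Rmult_le_pos; [exact: pos_INR | lra].
    have exp0 := exp_pos (- / rho).
    apply: Rle_trans (_ : 2 * (INR M + 1) ^ 2 * d * exp (- / rho) <= _).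
    { rewrite /eta. have -> : INR M * (d * ((2 * INR M + 2) * exp (- / rho))) =
        (INR M * (2 * INR M + 2)) * (d * exp (- / rho)) by ring.
      have -> : 2 * (INR M + 1) ^ 2 * d * exp (- / rho) = (2 * (INR M + 1) ^ 2) * (d * exp (- / rho)) by ring.
      apply: Rmult_le_compat_r; nra. }
    apply: Rle_trans (_ : 2 * (INR M + 1) ^ 2 * d * (Z * (hk ^ 2 * h)) <= _).
    { apply: Rmult_le_compat_l => //. apply: Rmult_le_pos; nra. }
    have -> : 2 * (INR M + 1) ^ 2 * d * (Z * (hk ^ 2 * h)) = ((INR M + 1) * hk) ^ 2 * (2 * d * Z * h) by ring.
    have -> : E * h = (D + 1) ^ 2 * (2 * d * Z * h) by rewrite /E /Z; ring.
    apply: Rmult_le_compat_r => //. apply: Rmult_le_pos; last lra. apply: Rmult_le_pos => //; lra. }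
  have X1 : forall x, In x (map xseq L) -> Rabs x <= 1.
  { move=> x /in_map_iff [j [<- hj]]. apply: xseq_le1. have := hL j hj. lia. }
  have diff : forall f, (forall a b, Rabs a <= 1 -> Rabs b <= 1 -> Rabs (f a - f b) <= d * Rabs (a - b)) ->
     forall q, Rabs (sum_at f (firstn q (map xseq L)) - sum_at f (firstn q P)) <= e / 2.
  { move=> f hf q. apply: Rle_trans (sum_at_Forall2 f (d * eta) _ _ _ _ q) tot; first nra.
    have iP : forall p, In p P -> Rabs p <= 1 by move=> p hp; have := inP p hp; rewrite -/rho; lra.
    elim: F2 X1 iP => [|x p X' P' hxp _ IH] X1 iP; first exact: Forall2_nil.
    constructor; last by apply: IH => z hz; [apply: X1; right | apply: iP; right].
    apply: Rle_trans (hf x p (X1 x (or_introl eq_refl)) (iP p (or_introl eq_refl))) _.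
    apply: Rmult_le_compat_l => //; lra. }
  have dp : forall i, (i <= k)%nat -> forall q,
     Rabs (sum_at (odd_pow i) (firstn q (map xseq L)) - sum_at (odd_pow i) (firstn q P)) <= e / 2.
  { move=> i hi. apply: diff => a b ha hb. apply: Rle_trans (pow_lip _ _ _ ha hb) _.
    apply: Rmult_le_compat_r; first exact: Rabs_pos. apply: le_INR. lia. }
  have tri : forall u v, Rabs u <= Rabs v + Rabs (u - v).
  { move=> u v. have := Rabs_triang v (u - v). replace (v + (u - v)) with u by ring. lra. }
  exists L; split; first by split. split; [|split; [|split]].
  - move=> q i hi. have := dp i ltac:(lia) q. have := P1 q i hi.
    have := tri (sum_at (odd_pow i) (firstn q (map xseq L))) (sum_at (odd_pow i) (firstn q P)). lra.
  - move=> q. have := dp k (le_n _) q. have := P2 q.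
    have := tri (sum_at (odd_pow k) (firstn q (map xseq L))) (sum_at (odd_pow k) (firstn q P)). lra.
  - have lenL : length (map xseq L) = M by exact: Forall2_length F2.
    have := dp k (le_n _) M. rewrite -{1}lenL !firstn_all => hh.
    have := Rabs_triang (sum_at (odd_pow k) (map xseq L) - sum_at (odd_pow k) P) (sum_at (odd_pow k) P - r).
    replace (sum_at (odd_pow k) (map xseq L) - sum_at (odd_pow k) P + (sum_at (odd_pow k) P - r)) with (sum_at (odd_pow k) (map xseq L) - r) by ring.
    lra.
  - have lenL : length (map xseq L) = M by exact: Forall2_length F2.
    have := diff (fun x => Rabs x ^ (2 * k + 2)) _ M. rewrite -{1}lenL !firstn_all => hh.
    have {}hh : Rabs (sum_at (fun x => Rabs x ^ (2 * k + 2)) (map xseq L) - sum_at (fun x => Rabs x ^ (2 * k + 2)) P) <= e / 2.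
    { apply: hh => a b ha hb. apply: Rle_trans (pow_lip _ _ _ _ _) _; try by rewrite Rabs_Rabsolu.
      apply: Rmult_le_compat_l; first exact: pos_INR. exact: Rabs_triang_inv2. }
    move/Rabs_le_between: hh. lra.
Qed.

Lemma sum_at_odd_polynomial (a : nat -> R) m P :
  sum_at (fun x => sum_f_R0 (fun i => a i * x ^ (2 * i + 1)) m) P = sum_f_R0 (fun i => a i * sum_at (odd_pow i) P) m.
Proof.
  elim: m => [|m IH]; first by rewrite /=; rewrite -sum_at_scal.
  rewrite tech5 -IH -sum_at_scal -sum_at_plus. by [].
Qed.

Section Reach.
Variables (g : nat -> R -> R) (al : nat -> nat -> R).
Hypothesis hg : forall i, odd_expansion (g i) (al i).

(** The bound C |r| + e on the partial sums leaves room for a constant C that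
    depends on t but not on r; subdivision removes it later. *)
Definition reach (d : nat) (t : nat -> R) : Prop :=
  exists C, 0 <= C /\ forall r e N, 0 < e -> exists L, fresh N L /\
    (forall q i, (i < d)%nat -> Rabs (sum_at (g i) (firstn q (map xseq L))) <= C * Rabs r + e) /\
    (forall i, (i < d)%nat -> Rabs (sum_at (g i) (map xseq L) - r * t i) <= e).

Lemma reach_ext d t t' : (forall i, (i < d)%nat -> t i = t' i) -> reach d t -> reach d t'.
Proof.
  move=> ht [C [C0 h]]. exists C; split => // r e N he. case: (h r e N he) => L [h1 [h2 h3]].
  exists L; split => //; split => // i hi. rewrite -ht //. exact: h3.
Qed.

Lemma reach_scal d c t : reach d t -> reach d (fun i => c * t i).
Proof.
  move=> [C [C0 h]]. exists (C * Rabs c); split; first by apply: Rmult_le_pos => //; exact: Rabs_pos.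
  move=> r e N he. case: (h (r * c) e N he) => L [h1 [h2 h3]]. exists L; split => //; split.
  - move=> q i hi. have := h2 q i hi. rewrite Rabs_mult. lra.
  - move=> i hi. have := h3 i hi. by rewrite Rmult_assoc.
Qed.

Lemma list_bound (L : list nat) N : exists N', (N <= N')%nat /\ forall j, In j L -> (j < N')%nat.
Proof.
  elim: L => [|j L [N' [h1 h2]]]; first by exists N.
  exists (N' + S j)%nat; split; first lia. move=> i [<-|hi]; first lia. have := h2 i hi; lia.
Qed.

Lemma fresh_app N N' L L' : fresh N L -> (N <= N')%nat -> (forall j, In j L -> (j < N')%nat) ->
  fresh N' L' -> fresh N (L ++ L').
Proof.
  move=> [n1 h1] hN hlt [n2 h2]. split.
  - apply: NoDup_app => // j hj hj'. have := hlt j hj. have := h2 j hj'. lia.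
  - move=> j /in_app_iff [hj|hj]; first exact: h1. have := h2 j hj; lia.
Qed.

Lemma firstn_app_cases {T} q (l1 l2 : list T) :
  firstn q (l1 ++ l2) = firstn q l1 \/ firstn q (l1 ++ l2) = l1 ++ firstn (q - length l1) l2.
Proof.
  rewrite firstn_app. case: (Nat.le_gt_cases q (length l1)) => h.
  - left. replace (q - length l1)%nat with 0%nat by lia. by rewrite firstn_O app_nil_r.
  - right. rewrite firstn_all2 //. lia.
Qed.

(** Perform one displacement after the other with fresh indices; the constants
    C add up. *)
Lemma reach_add d t t' : reach d t -> reach d t' -> reach d (fun i => t i + t' i).
Proof.
  move=> [C [C0 h]] [C' [C0' h']]. exists (C + C'); split; first lra.
  move=> r e N he. have he2 : 0 < e / 2 by lra.
  case: (h r (e / 2) N he2) => L [f1 [p1 q1]].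
  case: (list_bound L N) => N' [hN hlt].
  case: (h' r (e / 2) N' he2) => L' [f2 [p2 q2]].
  exists (L ++ L'); split; first exact: fresh_app f1 hN hlt f2. rewrite map_app.
  have r0 := Rabs_pos r. have cr : 0 <= C * Rabs r by nra. have cr' : 0 <= C' * Rabs r by nra. split.
  - move=> q i hi. case: (firstn_app_cases q (map xseq L) (map xseq L')) => ->.
    + have := p1 q i hi. lra.
    + rewrite sum_at_app. have := p1 (length (map xseq L)) i hi. rewrite firstn_all.
      have := p2 (q - length (map xseq L))%nat i hi.
      have := Rabs_triang (sum_at (g i) (map xseq L)) (sum_at (g i) (firstn (q - length (map xseq L)) (map xseq L'))). lra.
  - move=> i hi. rewrite sum_at_app. have := q1 i hi. have := q2 i hi.
    have := Rabs_triang (sum_at (g i) (map xseq L) - r * t i) (sum_at (g i) (map xseq L') - r * t' i).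
    replace (sum_at (g i) (map xseq L) - r * t i + (sum_at (g i) (map xseq L') - r * t' i)) with
      (sum_at (g i) (map xseq L) + sum_at (g i) (map xseq L') - r * (t i + t' i)) by ring. lra.
Qed.

Lemma finite_bound (Q : nat -> R -> Prop) d :
  (forall i B B', B <= B' -> Q i B -> Q i B') -> (forall i, exists B, Q i B) ->
  exists B, 0 <= B /\ forall i, (i < d)%nat -> Q i B.
Proof.
  move=> mono ex. elim: d => [|d [B [B0 IH]]]; first by exists 0; split; [lra | lia].
  case: (ex d) => B' hB'. exists (Rmax B B'); split; first by apply: Rle_trans B0 (Rmax_l _ _).
  move=> i hi. case: (Nat.eq_dec i d) => [->|n]; first by apply: mono hB'; exact: Rmax_r.
  apply: mono (Rmax_l _ _) _. apply: IH. lia.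
Qed.

(** A move of the k-th odd power sum by r changes the sum of g_i by r times the
    k-th coefficient of g_i: the lower terms of the expansion move by little, and
    the remainder is controlled by the sum of |x|^(2k+2). *)
Lemma reach_order d k : reach d (fun i => al i k).
Proof.
  have [B [B0 hB]] : exists B, 0 <= B /\ forall i, (i < d)%nat ->
     (forall x, Rabs x <= 1 -> Rabs (g i x - sum_f_R0 (fun l => al i l * x ^ (2 * l + 1)) k) <= B * Rabs x ^ (2 * k + 2))
     /\ sum_f_R0 (fun l => Rabs (al i l)) k <= B.
  { apply: (finite_bound (fun i B => (forall x, Rabs x <= 1 -> Rabs (g i x - sum_f_R0 (fun l => al i l * x ^ (2 * l + 1)) k) <= B * Rabs x ^ (2 * k + 2))
     /\ sum_f_R0 (fun l => Rabs (al i l)) k <= B)).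
    - move=> i B B' hBB [h1 h2]; split; last lra. move=> x hx. apply: Rle_trans (h1 x hx) _.
      apply: Rmult_le_compat_r => //. apply: pow_le; exact: Rabs_pos.
    - move=> i. case: (hg i k) => K [K0 hK]. exists (Rmax K (sum_f_R0 (fun l => Rabs (al i l)) k)); split; last exact: Rmax_r.
      move=> x hx. apply: Rle_trans (hK x hx) _. apply: Rmult_le_compat_r; last exact: Rmax_l.
      apply: pow_le; exact: Rabs_pos. }
  exists B; split => // r e N he.
  have he' : 0 < e / (2 * B + 1) by apply: Rdiv_lt_0_compat; lra.
  case: (move_power_sum k r _ N he') => L [[nd hL] [L1 [L2 [L3 L4]]]].
  set e' := e / (2 * B + 1) in he' L1 L2 L3 L4.
  have ee : (2 * B + 1) * e' = e by rewrite /e'; field; lra.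
  exists L; split; first by split => // j hj; have := hL j hj; lia.
  have X1 : forall x, In x (map xseq L) -> Rabs x <= 1.
  { move=> x /in_map_iff [j [<- hj]]. apply: xseq_le1. have := hL j hj. lia. }
  have rem : forall q i, (i < d)%nat -> Rabs (sum_at (g i) (firstn q (map xseq L)) -
     sum_f_R0 (fun l => al i l * sum_at (odd_pow l) (firstn q (map xseq L))) k) <= B * e'.
  { move=> q i hi. rewrite -sum_at_odd_polynomial.
    have -> : forall P u v, sum_at u P - sum_at v P = sum_at (fun x => u x + (-1) * v x) P.
    { move=> P u v. rewrite sum_at_plus sum_at_scal. ring. }
    apply: Rle_trans (sum_at_abs _ (fun x => B * Rabs x ^ (2 * k + 2)) _ _) _.
    - move=> p hp. have hp' : In p (map xseq L) by rewrite -(firstn_skipn q (map xseq L)); apply/in_app_iff; left.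
      have := proj1 (hB i hi) p (X1 p hp'). rewrite (_ : forall a b, a + -1 * b = a - b) //. move=> *; ring.
    - rewrite sum_at_scal. apply: Rmult_le_compat_l => //. apply: Rle_trans (sum_at_firstn_mono _ _ q _) L4.
      move=> p. apply: pow_le; exact: Rabs_pos. }
  have lin : forall (c s : nat -> R) b, (forall l, (l <= k)%nat -> Rabs (s l) <= b) ->
     Rabs (sum_f_R0 (fun l => c l * s l) k) <= sum_f_R0 (fun l => Rabs (c l)) k * b.
  { move=> c s b hs. apply: Rle_trans (Rsum_abs _ _) _. rewrite Rmult_comm scal_sum.
    apply: sum_Rle => l hl. rewrite Rabs_mult. apply: Rmult_le_compat_l; [exact: Rabs_pos | exact: hs]. }
  split.
  - move=> q i hi. have h1 := rem q i hi.
    have h2 := lin (al i) (fun l => sum_at (odd_pow l) (firstn q (map xseq L))) (Rabs r + e').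
    have {}h2 := h2 ltac:(move=> l hl; case: (Nat.eq_dec l k) => [->|n]; [exact: L2 | have := L1 q l ltac:(lia); have := Rabs_pos r; lra]).
    have h3 := proj2 (hB i hi).
    have : sum_f_R0 (fun l => Rabs (al i l)) k * (Rabs r + e') <= B * (Rabs r + e').
    { apply: Rmult_le_compat_r => //. have := Rabs_pos r; lra. }
    set S := sum_f_R0 _ _ in h1 h2. have := Rabs_triang (sum_at (g i) (firstn q (map xseq L)) - S) S.
    replace (sum_at (g i) (firstn q (map xseq L)) - S + S) with (sum_at (g i) (firstn q (map xseq L))) by ring. lra.
  - move=> i hi. have h1 := rem (length (map xseq L)) i hi. rewrite firstn_all in h1.
    have h2 := lin (al i) (fun l => sum_at (odd_pow l) (map xseq L) - (if Nat.eq_dec l k then r else 0)) e'.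
    have {}h2 : Rabs (sum_f_R0 (fun l => al i l * (sum_at (odd_pow l) (map xseq L) - (if Nat.eq_dec l k then r else 0))) k) <=
       sum_f_R0 (fun l => Rabs (al i l)) k * e'.
    { apply: h2 => l hl. case: Nat.eq_dec => [->|n] //. rewrite Rminus_0_r.
      have := L1 (length (map xseq L)) l ltac:(lia). by rewrite firstn_all. }
    have e1 : sum_f_R0 (fun l => al i l * (sum_at (odd_pow l) (map xseq L) - (if Nat.eq_dec l k then r else 0))) k =
       sum_f_R0 (fun l => al i l * sum_at (odd_pow l) (map xseq L)) k - r * al i k.
    { have e2 : forall m, (m < k)%nat -> sum_f_R0 (fun l => al i l * (sum_at (odd_pow l) (map xseq L) - (if Nat.eq_dec l k then r else 0))) m =
        sum_f_R0 (fun l => al i l * sum_at (odd_pow l) (map xseq L)) m.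
      { move=> m hm. apply: sum_eq => l hl. case: Nat.eq_dec => [e1|n]; first lia. ring. }
      case: (k) e2 => [|m] e2; first by rewrite /=; ring.
      rewrite !tech5 e2; last lia. case: Nat.eq_dec => [_|] //. ring. }
    rewrite e1 in h2. have h3 := proj2 (hB i hi).
    have : sum_f_R0 (fun l => Rabs (al i l)) k * e' <= B * e' by apply: Rmult_le_compat_r => //; lra.
    set S := sum_f_R0 _ _ in h1 h2. have := Rabs_triang (sum_at (g i) (map xseq L) - S) (S - r * al i k).
    replace (sum_at (g i) (map xseq L) - S + (S - r * al i k)) with (sum_at (g i) (map xseq L) - r * al i k) by ring. lra.
Qed.

(** Divide the displacement into Q equal parts.  During each of them the partial
    sums stray by little more than C / Q from their value at its beginning. *)
Lemma reach_segment d t e N : reach d t -> 0 < e -> exists L, fresh N L /\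
  (forall q i, (i < d)%nat -> Rabs (sum_at (g i) (firstn q (map xseq L))) <= Rabs (t i) + e) /\
  (forall i, (i < d)%nat -> Rabs (sum_at (g i) (map xseq L) - t i) <= e).
Proof.
  move=> [C [C0 hC]] he.
  case: (nfloor_ex (4 * C / e)) => [|n [_ hn]]; first by apply: Rdiv_le_0_compat; lra.
  set Q := S n. have hQ : 4 * C / e < INR Q by rewrite /Q S_INR.
  have Q0 : 1 <= INR Q by rewrite /Q S_INR; have := pos_INR n; lra.
  have hCQ : C / INR Q <= e / 4.
  { apply (Rmult_le_reg_r (INR Q)); first lra. replace (C / INR Q * INR Q) with C by (field; lra).
    apply (Rmult_lt_compat_r e) in hQ => //. replace (4 * C / e * e) with (4 * C) in hQ by (field; lra). lra. }
  set e' := e / (4 * INR Q). have he' : 0 < e' by apply: Rdiv_lt_0_compat; lra.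
  have eQ : INR Q * e' = e / 4 by rewrite /e'; field; lra.
  have e4 : e' <= e / 4 by nra.
  set r := / INR Q. have r0 : 0 < r by apply: Rinv_0_lt_compat; lra.
  have rQ : INR Q * r = 1 by rewrite /r; field; lra.
  have Cr : C * Rabs r = C / INR Q by rewrite Rabs_pos_eq //; lra.
  have main : forall q, (q <= Q)%nat -> exists L, fresh N L /\
     (forall s i, (i < d)%nat -> Rabs (sum_at (g i) (firstn s (map xseq L))) <= INR q * r * Rabs (t i) + INR q * e' + (C * Rabs r + e')) /\
     (forall i, (i < d)%nat -> Rabs (sum_at (g i) (map xseq L) - INR q * r * t i) <= INR q * e').
  { elim=> [|q IH] hq.
    - exists []; split; first by split; [exact: NoDup_nil |].
      have : 0 <= C * Rabs r by rewrite Cr; apply: Rdiv_le_0_compat; lra.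
      split => [s i _|i _]; rewrite ?firstn_nil /= ?Rabs_R0; first lra.
      replace (0 - 0 * r * t i) with 0 by ring. rewrite Rabs_R0; lra.
    - case: IH => [|L [f1 [p1 q1]]]; first lia.
      case: (list_bound L N) => N' [hN hlt]. case: (hC r e' N' he') => L' [f2 [p2 q2]].
      exists (L ++ L'); split; first exact: fresh_app f1 hN hlt f2. rewrite map_app.
      rewrite S_INR. have q0 := pos_INR q. split.
      + move=> s i hi. have ti := Rabs_pos (t i). have rt : 0 <= r * Rabs (t i) by nra.
        case: (firstn_app_cases s (map xseq L) (map xseq L')) => ->.
        * have := p1 s i hi. nra.
        * rewrite sum_at_app. have b1 := q1 i hi. have b2 := p2 (s - length (map xseq L))%nat i hi.
          set u := sum_at (g i) (map xseq L) in b1 *. set v := sum_at (g i) (firstn _ _) in b2 *.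
          have := Rabs_triang u v. have := Rabs_triang (u - INR q * r * t i) (INR q * r * t i).
          replace (u - INR q * r * t i + INR q * r * t i) with u by ring.
          have -> : Rabs (INR q * r * t i) = INR q * r * Rabs (t i).
          { rewrite Rabs_mult Rabs_pos_eq //. nra. }
          nra.
      + move=> i hi. rewrite sum_at_app. have := q1 i hi. have := q2 i hi.
        set u := sum_at (g i) (map xseq L). set v := sum_at (g i) (map xseq L').
        have := Rabs_triang (u - INR q * r * t i) (v - r * t i).
        replace (u - INR q * r * t i + (v - r * t i)) with (u + v - (INR q + 1) * r * t i) by ring. lra. }
  case: (main Q (le_n _)) => L [f [p q]]. exists L; split => //; split.
  - move=> s i hi. have := p s i hi. rewrite rQ eQ Cr. lra.
  - move=> i hi. have := q i hi. rewrite rQ eQ Rmult_1_l. lra.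
Qed.
End Reach.

(** * Every displacement is reachable; construction of the rearrangement *)

Lemma odd_expansion_odd_pow j : odd_expansion (odd_pow j) (fun i => if Nat.eq_dec i j then 1 else 0).
Proof.
  move=> m. exists 1; split; first lra. move=> x hx.
  have -> : sum_f_R0 (fun i => (if Nat.eq_dec i j then 1 else 0) * x ^ (2 * i + 1)) m =
    if le_lt_dec j m then odd_pow j x else 0.
  { elim: m => [|m IH].
    - cbn [sum_f_R0]. case: le_lt_dec => h; case: Nat.eq_dec => h'; try lia.
      + have -> : j = 0%nat by lia. rewrite /odd_pow /=. ring.
      + ring.
    - rewrite tech5 IH. case: Nat.eq_dec => h; case: le_lt_dec => h1; case: le_lt_dec => h2; try lia; try ring.
      by rewrite /odd_pow h; ring. }
  rewrite Rmult_1_l. have x0 := Rabs_pos x. case: le_lt_dec => h.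
  - rewrite Rminus_diag Rabs_R0. exact: pow_le.
  - rewrite Rminus_0_r /odd_pow -RPow_abs.
    have -> : (2 * j + 1 = (2 * m + 2) + (2 * (j - m - 1) + 1))%nat by lia.
    rewrite pow_add. have : Rabs x ^ (2 * (j - m - 1) + 1) <= 1 by rewrite -(pow1 (2 * (j - m - 1) + 1)); apply: pow_incr.
    have : 0 <= Rabs x ^ (2 * m + 2) by exact: pow_le. nra.
Qed.

(** The functions whose sums are prescribed.  F comes first, so that it is
    among the functions treated at every stage. *)
Definition with_odd_powers (f : R -> R) (i : nat) : R -> R :=
  match i with O => f | S j => odd_pow j end.

Definition with_odd_powers_coef (a : nat -> R) (i : nat) : nat -> R :=
  match i with O => a | S j => fun l => if Nat.eq_dec l j then 1 else 0 end.

(** For k >= d with a_k <> 0 the k-th coefficients of the first d functions are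
    (a_k, 0, ..., 0), so the first basis vector is reachable; the k-th
    coefficients for k < d then yield the other basis vectors. *)
Lemma reach_all f a d t : odd_expansion f a -> (forall n, exists k, (n <= k)%nat /\ a k <> 0) ->
  reach (with_odd_powers f) d t.
Proof.
  move=> hf ha.
  have hg : forall i, odd_expansion (with_odd_powers f i) (with_odd_powers_coef a i).
  { case=> [|j] //=. exact: odd_expansion_odd_pow. }
  have ord := reach_order _ _ hg d.
  pose e j := fun i => if Nat.eq_dec i j then 1 else 0.
  have r0 : reach (with_odd_powers f) d (e 0%nat).
  { case: (ha d) => k [hk ak]. apply: reach_ext (reach_scal _ d (/ a k) _ (ord k)).
    case=> [|i] hi; rewrite /e /=; first by field. case: Nat.eq_dec => h; [lia | ring]. }
  have rj : forall j, reach (with_odd_powers f) d (e j).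
  { case=> [|j] //. apply: reach_ext (reach_add _ d _ _ (ord j) (reach_scal _ d (- a j) _ r0)).
    case=> [|i] hi; rewrite /e /=; first ring.
    case: Nat.eq_dec => h1; case: Nat.eq_dec => h2; try lia; ring. }
  have : forall n, reach (with_odd_powers f) d (fun i => if le_lt_dec n i then 0 else t i).
  { elim=> [|n IH].
    - apply: reach_ext (reach_scal _ d 0 _ r0) => i _. rewrite Rmult_0_l. case: le_lt_dec => //; lia.
    - apply: reach_ext (reach_add _ d _ _ IH (reach_scal _ d (t n) _ (rj n))) => i _.
      rewrite /e. case: le_lt_dec => h1; case: Nat.eq_dec => h2; case: le_lt_dec => h3; try lia; rewrite ?h2; ring. }
  move=> /(_ d). apply: reach_ext => i hi. case: le_lt_dec => //; lia.
Qed.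

Lemma expansion_at_0 f a : odd_expansion f a -> forall e, 0 < e -> exists d, 0 < d /\
  forall x, Rabs x <= d -> Rabs (f x) <= e.
Proof.
  move=> hf e he. case: (hf 0%nat) => K [K0 hK].
  set B := K + Rabs (a 0%nat) + 1. have a0 := Rabs_pos (a 0%nat).
  have hB : 0 < B by rewrite /B; lra.
  exists (Rmin 1 (e / B)); split; first by apply: Rmin_pos; [lra | exact: Rdiv_lt_0_compat].
  move=> x hx. have m1 := Rmin_l 1 (e / B). have m2 := Rmin_r 1 (e / B).
  have := hK x ltac:(lra). rewrite /=. set u := a 0%nat * _. move=> h.
  have x0 := Rabs_pos x.
  have h2 : K * (Rabs x * (Rabs x * 1)) <= K * Rabs x by apply: Rmult_le_compat_l => //; nra.
  have h3 : Rabs u <= Rabs (a 0%nat) * Rabs x.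
  { rewrite /u Rmult_1_r Rabs_mult; lra. }
  have := Rabs_triang (f x - u) u. replace (f x - u + u) with (f x) by ring.
  have : B * Rabs x <= e.
  { apply: Rle_trans (_ : B * (e / B) <= e); first by apply: Rmult_le_compat_l; lra.
    apply: Req_le; field; lra. }
  rewrite /B. lra.
Qed.

Section Construction.
Variables (g : nat -> R -> R) (tau : nat -> R).
Hypothesis hreach : forall d t, reach g d t.
Hypothesis hzero : forall i e, 0 < e -> exists d, 0 < d /\ forall x, Rabs x <= d -> Rabs (g i x) <= e.

Definition total (i : nat) (L : list nat) : R := sum_at (g i) (map xseq L).

(** Accuracy 1 / (n + 1) of the block, plus the effect of appending the single
    index n. *)
Definition stage_error (n i : nat) : R := / INR (S n) + Rabs (g i (xseq n)).

(** Passage from the list A of indices used before stage n to the list A' used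
    after it.  The last bound controls the partial sums within the stage: they
    follow the segment from the old sum to the target. *)
Definition stage (n : nat) (A A' : list nat) : Prop :=
  NoDup A' /\ (exists E, A' = A ++ E) /\ In n A' /\ forall i, (i <= n)%nat ->
    Rabs (total i A' - tau i) <= stage_error n i /\
    forall q, (length A <= q)%nat ->
      Rabs (total i (firstn q A') - tau i) <= 2 * Rabs (total i A - tau i) + 2 * stage_error n i.

Lemma total_app i A B : total i (A ++ B) = total i A + total i B.
Proof. by rewrite /total map_app sum_at_app. Qed.

Lemma stage_exists n A : NoDup A -> exists A', stage n A A'.
Proof.
  move=> nd. set e := / INR (S n). have he : 0 < e by apply: Rinv_0_lt_compat; apply: lt_0_INR; lia.
  case: (list_bound A 0) => N [_ hN].
  case: (reach_segment _ (S n) _ e N (hreach (S n) (fun i => tau i - total i A)) he) => L [[ndL hL] [p q]].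
  have ndAL : NoDup (A ++ L).
  { apply: NoDup_app => // j hj hj'. have := hN j hj. have := hL j hj'. lia. }
  have AL : forall i, (i <= n)%nat -> Rabs (total i (A ++ L) - tau i) <= e.
  { move=> i hi. have := q i ltac:(lia). rewrite total_app.
    replace (total i A + total i L - tau i) with (total i L - (tau i - total i A)) by ring. by []. }
  have pre : forall i s, (i <= n)%nat -> (length A <= s)%nat ->
     Rabs (total i (firstn s (A ++ L)) - tau i) <= 2 * Rabs (total i A - tau i) + e.
  { move=> i s hi hs. rewrite firstn_app firstn_all2 // total_app {2}/total -firstn_map.
    have := p (s - length A)%nat i ltac:(lia). set v := sum_at _ _. rewrite (Rabs_minus_sym (tau i)).
    have := Rabs_triang (total i A - tau i) v.
    replace (total i A - tau i + v) with (total i A + v - tau i) by ring. lra. }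
  have gn0 : forall i, 0 <= Rabs (g i (xseq n)) by move=> i; exact: Rabs_pos.
  case: (in_dec Nat.eq_dec n (A ++ L)) => hin.
  - exists (A ++ L); split => //; split; first by exists L. split => // i hi. rewrite /stage_error -/e. split.
    + have := AL i hi. have := gn0 i. lra.
    + move=> s hs. have := pre i s hi hs. have := gn0 i. lra.
  - exists ((A ++ L) ++ [n]). 
    have last : forall i, (i <= n)%nat -> Rabs (total i ((A ++ L) ++ [n]) - tau i) <= stage_error n i.
    { move=> i hi. rewrite total_app /stage_error -/e.
      have -> : total i [n] = g i (xseq n) by rewrite /total /=; ring.
      have := AL i hi. have := Rabs_triang (total i (A ++ L) - tau i) (g i (xseq n)).
      replace (total i (A ++ L) - tau i + g i (xseq n)) with (total i (A ++ L) + g i (xseq n) - tau i) by ring. lra. }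
    split; first by apply: NoDup_app => //; [apply: NoDup_cons; [by [] | exact: NoDup_nil] | move=> j hj [e1|[]]; subst].
    split; first by exists (L ++ [n]); rewrite app_assoc.
    split; first by apply/in_app_iff; right; left.
    move=> i hi; split; first exact: last.
    move=> s hs. case: (Nat.le_gt_cases s (length (A ++ L))) => h.
    + rewrite firstn_app. replace (s - length (A ++ L))%nat with 0%nat by lia. rewrite firstn_O app_nil_r.
      have := pre i s hi hs. rewrite /stage_error -/e. have := gn0 i. lra.
    + rewrite firstn_all2; last by rewrite length_app /=; lia.
      have := last i hi. have : 0 <= stage_error n i by rewrite /stage_error -/e; have := gn0 i; lra.
      have := Rabs_pos (total i A - tau i). lra.
Qed.

Definition next_used (n : nat) (A : list nat) : list nat :=
  epsilon (inhabits []) (stage n A).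

Fixpoint used (n : nat) : list nat :=
  match n with O => [] | S k => next_used k (used k) end.

Lemma used_stage n : stage n (used n) (used (S n)).
Proof.
  have nd : NoDup (used n).
  { elim: n => [|n IH]; first exact: NoDup_nil. 
    exact: (proj1 (epsilon_spec (inhabits []) _ (stage_exists n _ IH))). }
  exact: (epsilon_spec (inhabits []) _ (stage_exists n _ nd)).
Qed.

Lemma used_prefix n m : (n <= m)%nat -> exists E, used m = used n ++ E.
Proof.
  elim=> [|m' _ [E IH]]; first by exists []; rewrite app_nil_r.
  case: (used_stage m') => _ [[E' e] _]. exists (E ++ E'). by rewrite e IH app_assoc.
Qed.

Lemma used_NoDup n : NoDup (used n).
Proof. case: n => [|n]; first exact: NoDup_nil. exact: (proj1 (used_stage n)). Qed.

Lemma used_In n : In n (used (S n)).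
Proof. by case: (used_stage n) => _ [_ []]. Qed.

Lemma used_length n : (n <= length (used n))%nat.
Proof.
  rewrite -{1}(length_seq n 0). apply: NoDup_incl_length; first exact: seq_NoDup.
  move=> j /in_seq hj. case: (used_prefix (S j) n ltac:(lia)) => E ->.
  apply/in_app_iff; left. exact: used_In.
Qed.

(** The lists [used] n extend each other, and the one of number j + 1 has more
    than j entries; so this reads off the entry number j of their limit. *)
Definition order (j : nat) : nat := nth j (used (S j)) 0%nat.

Lemma order_nth j m : (j < length (used m))%nat -> order j = nth j (used m) 0%nat.
Proof.
  move=> h. rewrite /order. have hj := used_length (S j).
  case: (Nat.le_ge_cases (S j) m) => hm.
  - case: (used_prefix _ _ hm) => E ->. rewrite app_nth1 //.
  - case: (used_prefix _ _ hm) => E ->. rewrite app_nth1 //.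
Qed.

Lemma order_inj i j : order i = order j -> i = j.
Proof.
  set m := S (max i j). have hm := used_length m.
  rewrite (order_nth i m); last by rewrite /m in hm *; lia. rewrite (order_nth j m); last by rewrite /m in hm *; lia.
  apply: (proj1 (NoDup_nth (used m) 0%nat) (used_NoDup m)); rewrite /m in hm *; lia.
Qed.

Lemma order_surj n : exists j, order j = n.
Proof.
  case: (In_nth _ _ 0%nat (used_In n)) => j [hj e]. exists j. by rewrite (order_nth j (S n)).
Qed.

Lemma order_bijective : Bijective order.
Proof.
  have ex : forall n, {j | order j = n} by move=> n; apply: constructive_indefinite_description; exact: order_surj.
  exists (fun n => proj1_sig (ex n)); split => n.
  - apply: order_inj. exact: (proj2_sig (ex (order n))).
  - exact: (proj2_sig (ex n)).
Qed.

Lemma order_sum i m k : (k < length (used m))%nat ->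
  sum_f_R0 (fun j => g i (xseq (order j))) k = total i (firstn (S k) (used m)).
Proof.
  elim: k => [|k IH] hk.
  - rewrite /= (order_nth 0 m) //. case: (used m) hk => [|j l] /=; first lia. move=> _. rewrite /total /=; ring.
  - rewrite tech5 IH; last lia. rewrite (order_nth (S k) m) //.
    have -> : firstn (S (S k)) (used m) = firstn (S k) (used m) ++ [nth (S k) (used m) 0%nat].
    { move: (used m) (S k) hk => l. elim: l => [|x l IHl] n hn; first by simpl in hn; lia.
      case: n hn => [|n] hn //. rewrite firstn_cons (IHl n) //; simpl in hn; lia. }
    rewrite total_app. congr (_ + _). rewrite /total /=; ring.
Qed.

Lemma stage_error_cv i e : 0 < e -> exists n0, forall n, (n0 <= n)%nat -> stage_error n i <= e.
Proof.
  move=> he. case: (hzero i (e / 2)) => [|d [hd h]]; first lra.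
  case: (xseq_cv d hd) => n1 h1.
  case: (nfloor_ex (2 / e)) => [|n2 [_ h2]]; first by apply: Rlt_le; apply: Rdiv_lt_0_compat; lra.
  exists (n1 + n2)%nat => n hn. rewrite /stage_error. have := h _ (h1 n ltac:(lia)).
  have : / INR (S n) <= e / 2.
  { have i2 : INR n2 <= INR n by apply: le_INR; lia. rewrite S_INR.
    replace (e / 2) with (/ (2 / e)) by (field; lra).
    apply: Rinv_le_contravar; first by apply: Rdiv_lt_0_compat; lra. lra. }
  lra.
Qed.

(** Once n is large the error at the end of each stage is at most e / 4, and so
    the partial sums inside the following stage stay within e. *)
Lemma order_cv i e : 0 < e -> exists K, forall k, (K <= k)%nat ->
  Rabs (sum_f_R0 (fun j => g i (xseq (order j))) k - tau i) <= e.
Proof.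
  move=> he. case: (stage_error_cv i (e / 4)) => [|n1 h1]; first lra.
  set n0 := (n1 + i)%nat.
  have settled : forall n, (n0 <= n)%nat -> Rabs (total i (used (S n)) - tau i) <= e / 4.
  { move=> n hn. case: (used_stage n) => _ [_ [_ h]]. have := proj1 (h i ltac:(rewrite /n0 in hn; lia)).
    have := h1 n ltac:(rewrite /n0 in hn; lia). lra. }
  have pre : forall n, (n0 < n)%nat -> forall q, (length (used (S n0)) <= q <= length (used n))%nat ->
     Rabs (total i (firstn q (used n)) - tau i) <= e.
  { move=> n; elim=> [|n' hn IH] q hq.
    - have -> : q = length (used (S n0)) by lia. rewrite firstn_all. have := settled n0 (le_n _). lra.
    - case: (Nat.le_gt_cases (length (used n')) q) => h.
      + case: (used_stage n') => _ [_ [_ hs]].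
        have := proj2 (hs i ltac:(rewrite /n0 in hn; lia)) q h.
        have := h1 n' ltac:(rewrite /n0 in hn; lia).
        have := settled (pred n') ltac:(lia). replace (S (pred n')) with n' by lia. lra.
      + case: (used_prefix n' (S n') ltac:(lia)) => E ->. rewrite firstn_app.
        replace (q - length (used n'))%nat with 0%nat by lia. rewrite firstn_O app_nil_r. apply: IH. lia. }
  exists (length (used (S n0))) => k hk.
  set m := (S k + S n0)%nat. have hm := used_length m.
  rewrite (order_sum i m); last by rewrite /m in hm *; lia.
  apply: pre; rewrite /m in hm *; lia.
Qed.
End Construction.

Lemma is_series_of_sums (u : nat -> R) l :
  (forall e, 0 < e -> exists K, forall k, (K <= k)%nat -> Rabs (sum_f_R0 u k - l) <= e) -> is_series u l.
Proof.
  move=> h. apply/filterlim_locally => eps.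
  case: (h (eps / 2)) => [|K hK]; first by have := cond_pos eps; lra.
  exists K => k hk. rewrite sum_n_Reals. apply: Rle_lt_trans (hK k hk) _. have := cond_pos eps; lra.
Qed.

Lemma is_series_RtoC (u : nat -> R) l : is_series u l ->
  @is_series C_AbsRing C_NormedModule (fun j => RtoC (u j)) (RtoC l).
Proof.
  move=> /filterlim_locally h. apply/filterlim_locally => eps. case: (h eps) => K hK.
  exists K => k hk.
  have -> : sum_n (fun j => RtoC (u j)) k = RtoC (sum_n u k).
  { elim: k {hk} => [|k IH]; first by rewrite !sum_O. by rewrite !sum_Sn IH /plus /= RtoC_plus. }
  split; first exact: hK. exact: ball_center.
Qed.

Theorem proposition5p7 (F : C -> C)
  (hF : real_odd_entire F) (hFnp : ~ polynomial_function F)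
  (mu : nat -> R) (c : R) :
  exists u : nat -> R,
    rearrangement u xseq /\
    (forall m : nat, is_series (fun j : nat => u j ^ (2 * m + 1)) (mu m)) /\
    @is_series C_AbsRing C_NormedModule (fun j : nat => F (RtoC (u j))) (RtoC c).
Proof.
  case: (real_odd_expansion F hF hFnp) => a [hre [hexp hinf]].
  set f := fun x : R => fst (F (RtoC x)) in hexp.
  pose g := with_odd_powers f.
  pose tau := fun i => match i with O => c | S m => mu m end.
  have hr : forall d t, reach g d t by move=> d t; exact: reach_all hexp hinf.
  have hz : forall i e, 0 < e -> exists d, 0 < d /\ forall x, Rabs x <= d -> Rabs (g i x) <= e.
  { case=> [|j] e he; first exact: expansion_at_0 hexp e he. exact: expansion_at_0 (odd_expansion_odd_pow j) e he. }
  have sums : forall i, is_series (fun j => g i (xseq (order g tau j))) (tau i).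
  { move=> i. apply: is_series_of_sums => e he. exact: order_cv. }
  exists (fun j => xseq (order g tau j)); split; [|split].
  - exists (order g tau); split => //. exact: order_bijective.
  - move=> m. exact: (sums (S m)).
  - apply: is_series_ext (is_series_RtoC _ _ (sums 0%nat)) => j. by rewrite [in RHS]hre.
Qed.
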